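(* Let $s\geq 2$ be an integer and let $t$ be an integer with $t>9^s\cdot s^{4s^{2/3}}$. Then $\mathrm{ex}(n,K_{s,t})=\Omega_s(n^{2-1/s})$; that is, there is a constant $c_s>0$ depending only on $s$ such that $\mathrm{ex}(n,K_{s,t})\geq c_s n^{2-1/s}$ for all sufficiently large $n$.
   Context: For a fixed graph $F$, $\mathrm{ex}(n,F)$ denotes the largest number of edges in an $n$-vertex graph that contains no copy of $F$ as a subgraph. $K_{s,t}$ is the complete bipartite graph with parts of sizes $s$ and $t$. *)

(* Defs.v *)
From HB Require Import structures.
From mathcomp Require Import all_boot.

Set Implicit Arguments.
Unset Strict Implicit.
Unset Printing Implicit Defensive.

(* A finite simple graph on V, given by its set of edges (2-element subsets). *)
Record sgraph (V : finType) := SGraph {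
  edges :> {set {set V}};
  _ : [forall e in edges, #|e| == 2] }.

HB.instance Definition _ (V : finType) := [isSub for @edges V].
HB.instance Definition _ (V : finType) := [Finite of sgraph V by <:].

(* The copy need not be induced. *)
Definition has_copy (U V : finType) (F : sgraph U) (G : sgraph V) : bool :=
  [exists f : {ffun U -> V},
    injectiveb f && [forall e in edges F, f @: e \in edges G]].

(* ex(n, F); equal to 0 in the degenerate case where every n-vertex graph contains F,
   i.e. when F has no edge and at most n vertices. *)
Definition extremal (n : nat) (U : finType) (F : sgraph U) : nat :=
  \max_(G : sgraph 'I_n | ~~ has_copy F G) #|edges G|.

Definition biclique_edges (s t : nat) : {set {set 'I_s + 'I_t}} :=
  [set [set inl p.1; inr p.2] | p in [set: 'I_s * 'I_t]].

Lemma biclique_subproof (s t : nat) :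
  [forall e in biclique_edges s t, #|e| == 2].
Proof. by apply/forall_inP => _ /imsetP[p _ ->]; rewrite cards2. Qed.

Definition biclique (s t : nat) : sgraph ('I_s + 'I_t)%type :=
  SGraph (biclique_subproof s t).

(* Main.v *)
(* Over the field with q = 2^j elements take two random varieties X, Y of
   dimension s in affine space of dimension m = 2s + r, with r about
   2 s^(2/3), each cut out by s cubics and r polynomials of degree D = s^2, and
   join x in X to y in Y when f(x, y) = 0 for a random f of bidegree (3, 3).
   The common neighbours of s points of X are the zeros of 2s cubics and r
   polynomials of degree D in m variables, so there are at most 9^s D^r of them
   once these polynomials form a regular sequence.  A random polynomial of
   degree d fails to prolong a regular sequence leaving dimension k with
   probability O(q^-N), N = 'C(k + d, d); this is O(q^-(s^2 + 1)) for the cubics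
   f(x_i, y), as k > r when they are used, and for the polynomials of degree D,
   as D + 1 > s^2.  It beats the O(q^(s^2)) tuples of s points of X.

   The f(x_i, y) are independent because the points of X impose independent
   conditions on cubics: by Edmonds' theorem a minimal dependent set contains
   3d + 2 points of a d-flat, all but one of which impose independent
   conditions, and such configurations are too rare to meet X.

   Regular sequences are handled without dimension theory.  The quotient A of
   the polynomial ring by the sequence is kept flat over the polynomial ring P
   in k linear forms.  Counting polynomials of degree at most n bounds the rank
   of A over P by the product of the degrees; for k = 0 this is Bezout's
   theorem.  If g + h is a zero divisor of A, with h in P, then - h is an
   eigenvalue of g on A, so at most rank A values of h are excluded: this gives
   the probability above.  When g is not a zero divisor, some nonzero N in P
   lies in g A; after a linear change of variables N is monic in the last form,
   and division by N shows that A / g A is flat over the other k - 1 forms. *)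

Require Import Defs.
From HB Require Import structures.
From mathcomp Require Import all_boot all_order all_algebra all_field.
From mathcomp Require Import boolp.
From mathcomp Require mpoly.
From mathcomp Require Import zify ring lra.

Set Implicit Arguments.
Unset Strict Implicit.
Unset Printing Implicit Defensive.

Module RandomVarieties.
Import mpoly GRing.Theory.
Local Open Scope ring_scope.

(** * Regular sequences and flatness *)

Section Ideals.
Variable S : comNzRingType.
Implicit Types (gs : seq S) (p u g : S).

Fixpoint ideal gs p : Prop :=
  if gs is g :: gs' then exists u, ideal gs' (p - u * g) else p = 0.

(* The head of the list is the polynomial added last. *)
Fixpoint regular gs : Prop :=
  if gs is g :: gs' then
    regular gs' /\ forall u, ideal gs' (g * u) -> ideal gs' u
  else True.

Lemma ideal0 gs : ideal gs 0.
Proof. by elim: gs => //= g gs IH; exists 0; rewrite mul0r subr0. Qed.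

Lemma idealD gs p q : ideal gs p -> ideal gs q -> ideal gs (p + q).
Proof.
elim: gs p q => [p q -> ->|g gs IH p q [u hu] [v hv]] /=; first by rewrite addr0.
by exists (u + v); rewrite mulrDl opprD addrACA; apply: IH.
Qed.

Lemma idealM gs a p : ideal gs p -> ideal gs (a * p).
Proof.
elim: gs p => [p ->|g gs IH p [u hu]] /=; first by rewrite mulr0.
by exists (a * u); rewrite -mulrA -mulrBr; apply: IH.
Qed.

Lemma idealN gs p : ideal gs p -> ideal gs (- p).
Proof. by rewrite -mulN1r; apply: idealM. Qed.

Lemma idealB gs p q : ideal gs p -> ideal gs q -> ideal gs (p - q).
Proof. by move=> hp hq; apply: idealD => //; apply: idealN. Qed.

Lemma ideal_sum gs (T : Type) (s : seq T) (P : pred T) (f : T -> S) :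
  (forall i, P i -> ideal gs (f i)) -> ideal gs (\sum_(i <- s | P i) f i).
Proof.
by move=> h; elim/big_ind: _ => //; [apply: ideal0|apply: idealD].
Qed.

Lemma ideal_cons g gs p : ideal gs p -> ideal (g :: gs) p.
Proof. by move=> h; exists 0; rewrite mul0r subr0. Qed.

End Ideals.

Section Flat.
Variable S : comNzRingType.
Implicit Type gs : seq S.

(* Flatness of S/(gs) over P through its equational criterion: every linear
   relation in the module is induced by relations in P. *)
Definition flat (P : comNzRingType) (phi : P -> S) gs : Prop :=
  forall (J : finType) (r : J -> P) (a : J -> S),
    ideal gs (\sum_j phi (r j) * a j) ->
    exists (T : finType) (b : J -> T -> P) (c : T -> S),
      (forall t, \sum_j r j * b j t = 0) /\
      (forall j, ideal gs (a j - \sum_t phi (b j t) * c t)).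

Lemma flat_torsion_free (P : idomainType) (phi : {rmorphism P -> S}) gs p a :
  flat phi gs -> p != 0 -> ideal gs (phi p * a) -> ideal gs a.
Proof.
move=> fl p0 h.
have [|T [b [c [hb hc]]]] := fl unit (fun _ => p) (fun _ => a).
  by rewrite (big_pred1 tt) // => -[].
have := hc tt; rewrite big1 ?subr0 // => t _.
have /eqP := hb t; rewrite (big_pred1 tt); last by case.
by rewrite mulf_eq0 (negPf p0) => /eqP ->; rewrite rmorph0 mul0r.
Qed.

Lemma flat_id : flat (idfun : S -> S) [::].
Proof.
move=> J r a /= h; exists unit, (fun j _ => a j), (fun _ => 1); split=> [t|j] //.
by rewrite (big_pred1 tt) ?mulr1 ?subrr // => -[].
Qed.

Lemma flat_surj (P P' : comNzRingType) (phi : P' -> S)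
    (psi : P -> S) (theta : {rmorphism P' -> P}) gs :
  (forall p, exists p', theta p' = p) ->
  (forall p, psi (theta p) = phi p) ->
  flat phi gs -> flat psi gs.
Proof.
move=> surj psiE fl J r a h.
have [r' hr'] := choice (fun j => surj (r j)).
have [|T [b [c [hb hc]]]] := fl J r' a.
  by move: h; congr ideal; apply: eq_bigr => j _; rewrite -psiE hr'.
exists T, (fun j t => theta (b j t)), c; split=> [t|].
  have := congr1 theta (hb t); rewrite rmorph0 rmorph_sum => e.
  by rewrite -[RHS]e; apply: eq_bigr => j _; rewrite rmorphM hr'.
move=> j; move: (hc j); congr (ideal _ (_ - _)); apply: eq_bigr => t _.
by rewrite psiE.
Qed.

Lemma flat_step (R : comNzRingType) (psi : {rmorphism {poly R} -> S}) gs g N :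
  flat psi gs -> N \is monic -> ideal (g :: gs) (psi N) ->
  flat (psi \o polyC) (g :: gs).
Proof.
move=> fl mN [g' hg'] J r a [w hw].
pose rr (j : J + unit) := if j is inl i then (r i)%:P else - N.
pose aa (j : J + unit) := if j is inl i then g' * a i else w.
have [|T [b [c [hb hc]]]] := fl _ rr aa.
  rewrite big_sumType /= [X in _ + X](big_pred1 tt) ; last by case.
  have := idealB (idealM g' hw) (idealM w hg').
  congr ideal; rewrite /= rmorphN mulrBr mulr_sumr.
  under eq_bigr do rewrite mulrCA.
  by ring.
pose Q j t := Pdiv.Ring.rdivp (b (inl j) t) N.
pose M j t := Pdiv.Ring.rmodp (b (inl j) t) N.
have QM j t : b (inl j) t = Q j t * N + M j t by apply: Pdiv.RingMonic.rdivp_eq.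
have key t : b (inr tt) t = \sum_j (r j)%:P * Q j t.
  have /eqP := hb t; rewrite big_sumType /= [X in _ + X](big_pred1 tt); last by case.
  rewrite /= mulNr subr_eq0 => /eqP e.
  set B := b (inr tt) t in e *.
  have e2 : (B - \sum_j (r j)%:P * Q j t) * N = \sum_j (r j)%:P * M j t.
    rewrite mulrBl mulr_suml [B * N]mulrC -e -sumrB; apply: eq_bigr => j _.
    by rewrite QM mulrDr mulrA [X in X - _]addrC addrK.
  have N0 := monic_neq0 mN.
  apply/eqP; rewrite -subr_eq0; apply: contraTT (leqnn (size N)) => nz.
  rewrite -ltnNge.
  have : (size ((B - \sum_j (r j)%:P * Q j t) * N)%R < size N)%N.
    rewrite e2; apply: leq_ltn_trans (size_sum _ _ _) _.
    rewrite (@leq_ltn_trans (size N).-1) //; last by rewrite ltn_predL size_poly_gt0.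
    apply/bigmax_leqP => j _; rewrite mul_polyC.
    apply: leq_trans (size_scale_leq _ _) _.
    by rewrite -ltnS prednK ?size_poly_gt0 // Pdiv.Ring.ltn_rmodpN0.
  rewrite size_Mmonic // => h.
  have := size_poly_gt0 (B - \sum_j (r j)%:P * Q j t); rewrite nz.
  by move: h (size_poly_gt0 N); rewrite N0; lia.
pose v j := \sum_t psi (Q j t) * c t.
have hv : ideal gs (w - \sum_j psi (r j)%:P * v j).
  have := hc (inr tt); congr ideal; congr (_ - _); rewrite /v.
  under [RHS]eq_bigr do rewrite mulr_sumr.
  rewrite exchange_big /=; apply: eq_bigr => t _.
  rewrite key rmorph_sum mulr_suml; apply: eq_bigr => j _.
  by rewrite rmorphM mulrA.
have [|T' [b' [c' [hb' hc']]]] := fl J (fun j => (r j)%:P) (fun j => a j - v j * g).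
  have := idealD hw (idealM g hv); congr ideal => /=.
  under [RHS]eq_bigr do rewrite mulrBr mulrA.
  rewrite sumrB -mulr_suml; ring.
pose n := \max_j \max_t size (b' j t).
have hn j t : (size (b' j t) <= n)%N.
  by apply: leq_trans (leq_bigmax j); apply: (leq_bigmax t).
exists (T' * 'I_n)%type, (fun j (te : T' * 'I_n) => (b' j te.1)`_(te.2 : nat)),
  (fun te : T' * 'I_n => psi 'X^(te.2) * c' te.1); split=> [[t e]|j] /=.
  have := congr1 (fun p : {poly R} => p`_e) (hb' t); rewrite /= coef0 coef_sum => h.
  by rewrite -[RHS]h; apply: eq_bigr => j _; rewrite coefCM.
exists (v j); have := hc' j; congr ideal; rewrite addrAC; congr (_ - _ - _).
rewrite -(pair_big xpredT xpredT
  (fun t (e : 'I_n) => psi ((b' j t)`_e)%:P * (psi 'X^e * c' t))) /=.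
apply: eq_bigr => t _.
have -> : b' j t = \sum_(e < n) (b' j t)`_e *: 'X^e.
  by rewrite -poly_def; apply/polyP => i; rewrite coef_poly;
    case: ltnP => // h; rewrite nth_default // (leq_trans (hn j t)).
rewrite rmorph_sum mulr_suml; apply: eq_bigr => e _.
rewrite coef_sum (bigD1 e) //= coefZ coefXn eqxx mulr1 big1 ?addr0.
  by rewrite -mul_polyC rmorphM mulrA.
by move=> i /negPf ne; rewrite coefZ coefXn -val_eqE /= eq_sym in ne *; rewrite ne mulr0.
Qed.

End Flat.

(** * Counting polynomials of bounded degree *)

(* The number of monomials of degree at most n in m variables. *)
Definition tau (m n : nat) : nat := 'C(n + m, m).

Lemma tauS j n : tau j.+1 n.+1 = (tau j.+1 n + tau j n.+1)%N.
Proof. by rewrite /tau addSn binS addSnnS. Qed.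

Lemma tau_n0 j : tau j 0 = 1%N.
Proof. by rewrite /tau add0n binn. Qed.

Lemma leq_tau m n n' : (n <= n')%N -> (tau m n <= tau m n')%N.
Proof. by move=> h; rewrite /tau leq_bin2l // leq_add2r. Qed.

Lemma tauS_sub j n d : (d <= n)%N ->
  (tau j.+1 n <= tau j.+1 (n - d) + d * tau j n)%N.
Proof.
elim: d n => [|d IH] n h; first by rewrite subn0 leq_addr.
case: n h => // n h.
rewrite subSS; rewrite tauS; apply: leq_trans (leq_add (IH n h) (leqnn _)) _.
rewrite -addnA leq_add2l mulSn addnC leq_add2l leq_mul2l leq_tau ?orbT //.
Qed.

Lemma tauS_small j n d : (n < d)%N -> (tau j.+1 n <= d * tau j n)%N.
Proof.
move=> h; have := tauS_sub j (leqnn n); rewrite subnn tau_n0 => h1.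
apply: leq_trans h1 _.
have : (0 < tau j n)%N by rewrite bin_gt0 leq_addl.
by move: (tau j n) h; nia.
Qed.

Lemma tau_sub m n E :
  (tau m (n + E) * (n + E) <= tau m n * (n + E) + E * m * tau m (n + E))%N.
Proof.
case: m => [|m]; first by rewrite /tau !bin0; lia.
have h := tauS_sub m (leq_addl n E); rewrite addnK in h.
have e : ((n + E + m.+1) * tau m (n + E) = m.+1 * tau m.+1 (n + E))%N.
  by rewrite /tau addnS mul_bin_diag.
have : (tau m.+1 (n + E) * (n + E) <= (tau m.+1 n + E * tau m (n + E)) * (n + E))%N.
  by rewrite leq_mul2r h orbT.
move=> h1; apply: leq_trans h1 _; rewrite mulnDl leq_add2l.
rewrite -!mulnA leq_mul2l -e mulnC leq_mul2r leq_addr !orbT //.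
Qed.

Lemma tau_growth m Pi E : exists n, (Pi * tau m (n + E) < Pi.+1 * tau m n)%N.
Proof.
pose n := (Pi.+1 * (E * m)).+1%N; exists n.
have h := tau_sub m n E.
have p1 : (0 < tau m (n + E))%N by rewrite bin_gt0 leq_addl.
have p2 : (0 < n + E)%N by [].
have hX : (Pi.+1 * (E * m * tau m (n + E)) < tau m (n + E) * (n + E))%N.
  have -> : (tau m (n + E) * (n + E) =
    Pi.+1 * (E * m * tau m (n + E)) + tau m (n + E) * E.+1)%N.
    by rewrite {2}/n; move: (E * m)%N (tau _ _) => x y; rewrite addSnnS mulnDr mulnC -mulnA.
  by rewrite -[leqLHS]addn1 leq_add2l muln_gt0 p1.
rewrite -(ltn_pmul2r p2) -!mulnA.
have := leq_mul (leqnn Pi.+1) h; rewrite mulnDr mulSn.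
move: hX; set X := (tau m (n + E) * _)%N; set Y := (tau m n * _)%N.
by move: (_ * (_ * tau _ _))%N => Z; lia.
Qed.

Lemma card_bmnm m n : #|{: 'X_{1..m < n.+1}}| = tau m n.
Proof.
rewrite /tau addnC -card_partial_ord_partitions.
pose f (x : 'X_{1..m < n.+1}) : m.-tuple 'I_n.+1 := [tuple inord ((val x) i) | i < m].
have fE x i : tnth (f x) i = (val x) i :> nat.
  rewrite tnth_mktuple inordK //.
  apply: leq_ltn_trans (bmdeg x); rewrite mdegE (bigD1 i) //= leq_addr //.
have sumf x : (\sum_(i <- f x) i = mdeg (val x))%N.
  by rewrite mdegE big_tuple; apply: eq_bigr => i _; rewrite fE.
have inj : injective f.
  move=> x y e; apply/val_inj/mnmP => i.
  by rewrite -!fE e.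
rewrite -(card_imset _ inj); apply: eq_card => t; rewrite inE.
apply/imsetP/idP => [[x _ ->]|h]; first by rewrite sumf -ltnS bmdeg.
have hm : (mdeg [multinom (tnth t i : nat) | i < m] < n.+1)%N.
  rewrite ltnS mdegE; move: h; rewrite big_tuple; congr (_ <= _)%N.
  by apply: eq_bigr => i _; rewrite mnmE.
exists (BMultinom hm) => //; apply: eq_from_tnth => i; apply: val_inj.
by rewrite /= fE /= mnmE.
Qed.

Section Count.
Variables (F : finFieldType) (m : nat).
Local Notation S := {mpoly F[m]}.
Implicit Types (gs : seq S) (g : S).

Definition free_upto gs (n N : nat) : Prop :=
  exists (T : finType) (w : T -> S),
    [/\ #|T| = N, forall t, (msize (w t) <= n.+1)%N
      & forall l : T -> F, ideal gs (\sum_t l t *: w t) -> forall t, l t = 0].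

Lemma free_upto_weaken g gs n N : free_upto (g :: gs) n N -> free_upto gs n N.
Proof.
move=> [T [w [h1 h2 h3]]]; exists T, w; split=> // l hl; apply: h3.
exact: ideal_cons.
Qed.

Lemma msize_mul_leq (p q : S) a b :
  (msize p <= a.+1)%N -> (msize q <= b.+1)%N -> (msize (p * q) <= (a + b).+1)%N.
Proof.
have [->|p0] := eqVneq p 0; first by rewrite mul0r msize0.
have [->|q0] := eqVneq q 0; first by rewrite mulr0 msize0.
by rewrite msizeM // => hp hq; move: (leq_add hp hq); rewrite addnS addSn; case: (_ + _)%N.
Qed.

(* As g is regular modulo gs, the families w modulo g :: gs and g * w' modulo
   gs are independent of each other. *)
Lemma free_upto_add g gs n n' d N N' :
  free_upto (g :: gs) n N -> free_upto gs n' N' -> (n' + d = n)%N ->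
  (msize g <= d.+1)%N -> (forall u, ideal gs (g * u) -> ideal gs u) ->
  free_upto gs n (N + N').
Proof.
move=> [T [w [h1 h2 h3]]] [T' [w' [h1' h2' h3']]] en hg nzd.
exists (T + T')%type, (fun t => match t with inl t => w t | inr t => w' t * g end).
split=> [|[t|t]|l]; first by rewrite card_sum h1 h1'.
- exact: h2.
- by rewrite -en; apply: msize_mul_leq.
rewrite big_sumType /= => hl.
have e1 t : l (inl t) = 0.
  apply: (h3 (fun t => l (inl t))).
  exists (- \sum_t' l (inr t') *: w' t').
  move: hl; congr ideal; rewrite mulNr opprK; congr (_ + _).
  by rewrite mulr_suml; apply: eq_bigr => i _; rewrite scalerAl.
have e2 t : l (inr t) = 0.
  apply: (h3' (fun t => l (inr t))); apply: nzd; move: hl.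
  rewrite big1 ?add0r => [|i _]; last by rewrite e1 scale0r.
  congr ideal; rewrite mulr_sumr; apply: eq_bigr => i _.
  by rewrite -scalerAr [g * _]mulrC.
by case.
Qed.

Lemma free_upto_bound n N : free_upto [::] n N -> (N <= tau m n)%N.
Proof.
move=> [T [w [<- hw free]]].
pose f (l : {ffun T -> F}) : {ffun 'X_{1..m < n.+1} -> F} :=
  [ffun x => (\sum_t l t *: w t)@_(val x)].
have inj : injective f.
  move=> l l' /ffunP e; apply/ffunP => t; apply/eqP; rewrite -subr_eq0; apply/eqP.
  apply: (free (fun t => l t - l' t)) => /=.
  have -> : \sum_t (l t - l' t) *: w t = \sum_t l t *: w t - \sum_t l' t *: w t.
    by rewrite -sumrB; apply: eq_bigr => i _; rewrite scalerBl.
  apply/mpolyP => x; rewrite mcoeffB mcoeff0.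
  have [hx|hx] := ltnP (mdeg x) n.+1.
    by have := e (BMultinom hx); rewrite !ffunE /= => ->; rewrite subrr.
  have big (k : {ffun T -> F}) : (\sum_t k t *: w t)@_x = 0.
    apply: memN_msupp_eq0; apply: msize_mdeg_ge; apply: leq_trans hx.
    apply: leq_trans (msize_sum _ _ _) _; apply/bigmax_leqP_seq => t' _ _.
    by apply: leq_trans (hw t'); have [->|?] := eqVneq (k t') 0;
      rewrite ?scale0r ?msize0 // msizeZ.
  by rewrite !big subrr.
have := leq_card f inj; rewrite !card_ffun card_bmnm leq_exp2l //.
exact: card_finRing_gt1.
Qed.

Lemma count_step g gs (M E c Pi d j : nat) :
  (forall n, (n <= M)%N -> exists N, free_upto (g :: gs) (n + E) N /\ (c * tau j n <= Pi * N)%N) ->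
  (0 < d)%N -> (msize g <= d.+1)%N -> (forall u, ideal gs (g * u) -> ideal gs u) ->
  forall n, (n <= M)%N ->
    exists N, free_upto gs (n + E) N /\ (c * tau j.+1 n <= Pi * d * N)%N.
Proof.
move=> base d0 hg nzd; elim/ltn_ind => n IH hn.
have [N [fN cN]] := base n hn.
have [nd|dn] := ltnP n d.
  exists N; split; first exact: free_upto_weaken fN.
  apply: (@leq_trans (c * (d * tau j n))); first by rewrite leq_mul2l tauS_small ?orbT.
  by rewrite mulnCA -mulnA [(Pi * _)%N]mulnCA leq_mul2l cN orbT.
have [||N' [fN' cN']] := IH (n - d)%N; try lia.
exists (N + N')%N; split.
  by apply: (free_upto_add (d := d) fN fN') => //; rewrite addnAC subnK.
have h := tauS_sub j dn.
apply: (@leq_trans (c * (tau j.+1 (n - d) + d * tau j n))).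
  by rewrite leq_mul2l h orbT.
rewrite !mulnDr addnC leq_add //.
by rewrite mulnCA -mulnA [(Pi * _)%N]mulnCA leq_mul2l cN orbT.
Qed.

Definition bounded_by gs (ds : seq nat) : bool :=
  all2 (fun g d => (msize g <= d.+1)%N && (0 < d)%N) gs ds.

(* Summing free_upto_add over the powers of the head divides the count by its
   degree and increases the number of free variables by one. *)
Lemma regular_count gs ds (M E c k : nat) : bounded_by gs ds -> regular gs ->
  (forall n, (n <= M)%N -> exists N, free_upto gs (n + E) N /\ (c * tau k n <= N)%N) ->
  forall n, (n <= M)%N ->
    (c * tau (k + size gs) n <= \prod_(d <- ds) d * tau m (n + E))%N.
Proof.
have gen Pi gs' ds' k' : bounded_by gs' ds' -> regular gs' ->
  (forall n, (n <= M)%N ->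
     exists N, free_upto gs' (n + E) N /\ (c * tau k' n <= Pi * N)%N) ->
  forall n, (n <= M)%N ->
    (c * tau (k' + size gs') n <= Pi * \prod_(d <- ds') d * tau m (n + E))%N.
  elim: gs' ds' k' Pi => [|g gs' IH] [|d ds'] k' Pi //=.
    move=> _ _ base n hn; rewrite big_nil muln1 addn0.
    have [N [fN cN]] := base n hn; apply: leq_trans cN _.
    by rewrite leq_mul2l (free_upto_bound fN) orbT.
  move=> /andP[/andP[hg d0] hall] [reg nzd] base n hn.
  rewrite big_cons mulnA -addSnnS; apply: IH => // n' hn'.
  exact: (count_step base).
move=> h1 h2 base n hn; rewrite -[X in (_ <= X * _)%N]mul1n; apply: gen => // n' hn'.
by have [N [? ?]] := base n' hn'; exists N; rewrite mul1n.
Qed.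

Definition linear_forms k (L : k.-tuple S) : bool := [forall i, (msize (tnth L i) <= 2)%N].

Lemma msize_prod_exp k (L : k.-tuple S) (mon : 'X_{1..k}) : linear_forms L ->
  (msize (\prod_(i < k) tnth L i ^+ mon i)%R <= (mdeg mon).+1)%N.
Proof.
move=> /forallP hL; rewrite mdegE.
elim/big_ind2: _ => [|p a q b hp hq|i _]; first by rewrite msizeC oner_neq0.
  exact: msize_mul_leq.
elim: (mon i) => [|e IH]; first by rewrite expr0 msizeC oner_neq0.
by rewrite exprS; apply: (@msize_mul_leq _ _ 1 e).
Qed.

Lemma msize_comp k (L : k.-tuple S) p : linear_forms L ->
  (msize (p \mPo L) <= msize p)%N.
Proof.
move=> hL; rewrite comp_mpolyE; apply: leq_trans (msize_sum _ _ _) _.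
apply/bigmax_leqP_seq => mon hm _; apply: leq_trans (msize_mdeg_lt hm).
have [->|?] := eqVneq p@_mon 0; first by rewrite scale0r msize0.
by rewrite msizeZ // msize_prod_exp.
Qed.

Lemma count_free gs ds k (L : k.-tuple S) (T : finType) (w : T -> S) E M :
  bounded_by gs ds -> regular gs -> linear_forms L ->
  (forall t, (msize (w t) <= E.+1)%N) ->
  (forall p : T -> {mpoly F[k]}, (forall t, msize (p t) <= M.+1)%N ->
     ideal gs (\sum_t (p t \mPo L) * w t) -> forall t, p t = 0) ->
  forall n, (n <= M)%N ->
    (#|T| * tau (k + size gs) n <= \prod_(d <- ds) d * tau m (n + E))%N.
Proof.
move=> hb hr hL hw free; apply: regular_count => // n hn.
exists (#|T| * tau k n)%N; split=> //.
exists (T * 'X_{1..k < n.+1})%type, (fun t => ('X_[val t.2] \mPo L) * w t.1); split.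
- by rewrite card_prod card_bmnm.
- move=> [t x] /=; apply: msize_mul_leq => //; apply: leq_trans (msize_comp _ hL) _.
  by rewrite msizeX bmdeg.
move=> l hl [t x].
pose p t := \sum_(x : 'X_{1..k < n.+1}) l (t, x) *: 'X_[val x].
have pE y : (p t)@_(val y) = l (t, y).
  rewrite raddf_sum (bigD1 y) //= mcoeffZ mcoeffX eqxx mulr1 big1 ?addr0 // => z nz.
  by rewrite mcoeffZ mcoeffX; case: eqP => [/val_inj /eqP|]; rewrite ?(negPf nz) ?mulr0.
rewrite -pE (free p) ?mcoeff0 // => [t'|].
  apply: leq_trans (msize_sum _ _ _) _; apply/bigmax_leqP_seq => y _ _.
  have [->|?] := eqVneq (l (t', y)) 0; first by rewrite scale0r msize0.
  by rewrite msizeZ // msizeX; apply: leq_trans (bmdeg y) _.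
move: hl; congr ideal.
transitivity (\sum_t' \sum_(y : 'X_{1..k < n.+1}) l (t', y) *: (('X_[val y] \mPo L) * w t')).
  by rewrite pair_big; apply: eq_bigr => -[].
apply: eq_bigr => t' _; rewrite [p t']/p raddf_sum mulr_suml; apply: eq_bigr => y _.
by rewrite /= comp_mpolyZ scalerAl.
Qed.

Lemma rank_bound gs ds k (L : k.-tuple S) (T : finType) (w : T -> S) :
  bounded_by gs ds -> regular gs -> linear_forms L -> (k + size gs = m)%N ->
  (forall p : T -> {mpoly F[k]},
     ideal gs (\sum_t (p t \mPo L) * w t) -> forall t, p t = 0) ->
  (#|T| <= \prod_(d <- ds) d)%N.
Proof.
move=> hb hr hL em free; pose E := (\max_t msize (w t))%N.
have [n hn] := tau_growth m (\prod_(d <- ds) d) E.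
have hw t : (msize (w t) <= E.+1)%N by apply: leqW; apply: leq_bigmax.
have := @count_free gs ds k L T w E n hb hr hL hw _ n (leqnn n).
rewrite em => /(_ (fun p _ => free p)) h; rewrite leqNgt; apply/negP => h2.
have p0 : (0 < tau m n)%N by rewrite bin_gt0 leq_addl.
by have := leq_ltn_trans h hn; rewrite ltn_pmul2r // ltnNge h2.
Qed.

End Count.

Lemma bounded_relation m Pi E : exists M, forall (F : finFieldType) (gs : seq {mpoly F[m]}) ds
    k (L : k.-tuple {mpoly F[m]}) (T : finType) (w : T -> {mpoly F[m]}),
  bounded_by gs ds -> regular gs -> linear_forms L -> (k + size gs = m)%N ->
  (\prod_(d <- ds) d = Pi)%N -> (Pi < #|T|)%N -> (forall t, (msize (w t) <= E.+1)%N) ->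
  exists p : T -> {mpoly F[k]},
    [/\ forall t, (msize (p t) <= M.+1)%N, ideal gs (\sum_t (p t \mPo L) * w t)
      & exists t, p t != 0].
Proof.
have [n hn] := tau_growth m Pi E; exists n => F gs ds k L T w hb hr hL em ePi hT hw.
apply: contrapT => no.
have := @count_free F m gs ds k L T w E n hb hr hL hw _ n (leqnn n).
rewrite em ePi => h; have {}h := h _.
have p0 : (0 < tau m n)%N by rewrite bin_gt0 leq_addl.
have : (#|T| * tau m n < Pi.+1 * tau m n)%N.
  apply: leq_ltn_trans hn; apply: h => p hp hI t.
  apply/eqP; apply: contraT => nz; case: no; exists p; split=> //; by exists t.
by rewrite ltn_pmul2r // ltnNge hT.
Qed.

(** * Linear changes of variables *)

Lemma eq_mpoly_rmorph (R : comNzRingType) (A : comNzRingType) k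
    (f g : {rmorphism {mpoly R[k]} -> A}) :
  (forall c, f c%:MP = g c%:MP) -> (forall i, f 'X_i = g 'X_i) -> f =1 g.
Proof.
move=> hC hX p; rewrite [p]mpolyE !rmorph_sum; apply: eq_bigr => x _ /=.
rewrite -mul_mpolyC !rmorphM hC; congr (_ * _).
rewrite mpolyXE_id !rmorph_prod; apply: eq_bigr => i _.
by rewrite !rmorphXn hX.
Qed.

Lemma poly_nonroot (F : finFieldType) (p : {poly F}) :
  p != 0 -> (size p <= #|F|)%N -> exists c, p.[c] != 0.
Proof.
move=> p0 hs; apply: contrapT => no.
have all0 c : root p c by apply/contraT => h; case: no; exists c.
have := max_poly_roots p0 (introT allP (fun c _ => all0 c)) (enum_uniq F).
by rewrite -cardE ltnNge hs.
Qed.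

Section Shear.
Variables (F : finFieldType) (k : nat).
Local Notation W := (widen_ord (leqnSn k)).

Definition last_or (T : Type) (x : T) (f : 'I_k -> T) (i : 'I_k.+1) : T :=
  if unlift ord_max i is Some j then f j else x.

Lemma lift_maxE (i : 'I_k) : lift ord_max i = W i.
Proof. by apply: val_inj; rewrite /= /bump leqNgt ltn_ord. Qed.

Lemma last_orW T x (f : 'I_k -> T) i : last_or x f (W i) = f i.
Proof. by rewrite /last_or -lift_maxE liftK. Qed.

Lemma last_or_max T x (f : 'I_k -> T) : last_or x f ord_max = x.
Proof. by rewrite /last_or unlift_none. Qed.

Lemma ord_lastP (P : 'I_k.+1 -> Prop) :
  (forall i, P (W i)) -> P ord_max -> forall i, P i.
Proof.
move=> h1 h2 i; case: (unliftP ord_max i) => [j|] -> //.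
by rewrite lift_maxE.
Qed.

Lemma mpoly_nonroot_step (p : {mpoly F[k.+1]}) (v : 'I_k -> F) (t : F) :
  p.@[last_or t v] = (map_poly (meval v) (muni p)).[t].
Proof.
pose f := horner_eval t \o map_poly (meval v) \o @muni k F.
apply: (@eq_mpoly_rmorph _ _ _ (meval (last_or t v)) f) => [c|i].
  by rewrite /f /= mevalC muniC map_polyC /= mevalC horner_evalE hornerC.
rewrite /f /= mevalXU /muni mmapX mmap1U /horner_eval.
case: splitP => [j e|j e].
  rewrite map_polyC /= mevalXU hornerC; have -> : i = W j by apply: val_inj.
  by rewrite last_orW.
rewrite map_polyX hornerX; have -> : i = ord_max.
  by apply: val_inj; move: e; rewrite /= ord1 addn0.
by rewrite last_or_max.
Qed.

End Shear.

Lemma size_muni (F : finFieldType) k (p : {mpoly F[k.+1]}) :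
  (size (muni p) <= msize p)%N.
Proof.
rewrite muniE; apply: leq_trans (size_sum _ _ _) _; apply/bigmax_leqP_seq => x hx _.
apply: leq_trans (size_scale_leq _ _) _.
rewrite size_polyXn; apply: leq_trans (msize_mdeg_lt hx).
by rewrite ltnS mdegE (bigD1 ord_max) //= leq_addr.
Qed.

Lemma msize_muni_coef (F : finFieldType) k (p : {mpoly F[k.+1]}) i :
  (msize (muni p)`_i <= msize p)%N.
Proof.
rewrite muniE coef_sum; apply: leq_trans (msize_sum _ _ _) _.
apply/bigmax_leqP_seq => x hx _; rewrite !coefZ coefXn.
apply: leq_trans (msize_mdeg_lt hx).
case: eqP => _; last by rewrite mulr0 msize0.
rewrite mulr1; have [->|?] := eqVneq p@_x 0; first by rewrite scale0r msize0.
rewrite msizeZ // msizeX ltnS !mdegE big_ord_recr /=.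
by under eq_bigr do rewrite mnmE; apply: leq_addr.
Qed.

Lemma muni_eq0 (F : finFieldType) k (p : {mpoly F[k.+1]}) : muni p = 0 -> p = 0.
Proof.
move=> e; pose back (q : {poly {mpoly F[k]}}) := (map_poly (@mwiden k F) q).['X_ord_max].
suff -> : p = back (muni p) by rewrite e /back map_poly0 horner0.
pose f := horner_eval 'X_ord_max \o map_poly (@mwiden k F) \o @muni k F.
apply: (@eq_mpoly_rmorph _ _ _ idfun f) => [c|i].
  by rewrite /f /= muniC map_polyC /= mwidenC horner_evalE hornerC.
rewrite /f /= /muni mmapX mmap1U /horner_eval.
case: splitP => [j e'|j e'].
  rewrite map_polyC /= mwidenX hornerC mnmwiden1; congr 'X__.
  by apply: val_inj.
rewrite map_polyX hornerX; congr 'X_(_).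
by apply: val_inj; move: e'; rewrite /= ord1 addn0.
Qed.

Lemma mpoly_nonroot (F : finFieldType) k (p : {mpoly F[k]}) :
  p != 0 -> (msize p <= #|F|)%N -> exists v : 'I_k -> F, p.@[v] != 0.
Proof.
elim: k p => [|k IH] p p0 hp.
  exists (fun=> 0); rewrite [p]nvar0_mpolyC mevalC.
  by apply: contra p0 => /eqP e; rewrite [p]nvar0_mpolyC e mpolyC0.
have /polyP h : muni p <> 0 by move/muni_eq0/eqP; apply/negP.
have [i hi] : exists i, (muni p)`_i != 0.
  apply: contrapT => no; apply: h => i; rewrite coef0; apply/eqP.
  by apply: contraT => hi; case: no; exists i.
have [v hv] := IH _ hi (leq_trans (msize_muni_coef _ _) hp).
have [||t ht] := @poly_nonroot F (map_poly (meval v) (muni p)).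
- apply: contra hv => /eqP/polyP/(_ i); rewrite coef_map coef0 => /= ->; exact: eqxx.
- apply: leq_trans (size_poly _ _) _.
  exact: leq_trans (size_muni _) hp.
by exists (last_or t v); rewrite mpoly_nonroot_step.
Qed.

Lemma coefM_top (R : nzSemiRingType) (p q : {poly R}) a b :
  (size p <= a.+1)%N -> (size q <= b.+1)%N -> (p * q)`_(a + b) = p`_a * q`_b.
Proof.
move=> hp hq; have la : (a < (a + b).+1)%N by rewrite ltnS leq_addr.
rewrite coefM (bigD1 (Ordinal la)) //= addKn big1 ?addr0 // => i.
rewrite -val_eqE /= neq_ltn => /orP[h|h].
  by rewrite [q`_ _]nth_default ?mulr0 //; apply: leq_trans hq _; lia.
by rewrite [p`_ _]nth_default ?mul0r //; apply: leq_trans hp _.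
Qed.

Section Shear.
Variables (F : finFieldType) (k : nat) (c : 'I_k -> F).
Local Notation W := (widen_ord (leqnSn k)).

Definition shear_var : 'I_k.+1 -> {poly {mpoly F[k]}} :=
  last_or 'X (fun i => ('X_i)%:P + (c i)%:MP *: 'X).

Definition shear : {mpoly F[k.+1]} -> {poly {mpoly F[k]}} :=
  mmap (polyC \o @mpolyC k F) shear_var.

HB.instance Definition _ := GRing.RMorphism.on shear.

Lemma shearX i : shear 'X_i = shear_var i.
Proof. by rewrite /shear mmapX mmap1U. Qed.

Lemma shearC a : shear a%:MP = a%:MP%:P.
Proof. by rewrite /shear mmapC. Qed.

Lemma shear_surj p : exists p', shear p' = p.
Proof.
elim/poly_ind: p => [|p b [p' <-]]; first by exists 0; rewrite rmorph0.
pose L := [tuple 'X_(W i) - (c i)%:MP * 'X_ord_max | i < k] : k.-tuple {mpoly F[k.+1]}.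
exists (p' * 'X_ord_max + (b \mPo L)); rewrite rmorphD rmorphM /= shearX /shear_var last_or_max.
congr (_ + _).
apply: (@eq_mpoly_rmorph _ _ _ (shear \o comp_mpoly L) polyC) => [a|i] /=.
  by rewrite comp_mpolyC shearC.
rewrite comp_mpolyXU -tnth_nth tnth_mktuple rmorphB rmorphM /= !shearX shearC /shear_var.
by rewrite last_or_max last_orW mul_polyC addrK.
Qed.

(* The part of top degree of N, dehomogenized at the last variable. *)
Definition shear_top (N : {mpoly F[k.+1]}) : {mpoly F[k]} :=
  \sum_(x <- msupp N | mdeg x == (msize N).-1) N@_x *: 'X_[[multinom x (W i) | i < k]].

Lemma shear_mon (x : 'X_{1..k.+1}) :
  (size (shear 'X_[x]) <= (mdeg x).+1)%N /\
  (shear 'X_[x])`_(mdeg x) = (\prod_(i < k) c i ^+ x (W i))%:MP.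
Proof.
have -> : \prod_(i < k) c i ^+ x (W i) = \prod_(i < k.+1) last_or 1 c i ^+ x i.
  rewrite big_ord_recr /= last_or_max expr1n mulr1.
  by apply: eq_bigr => i _; rewrite last_orW.
rewrite mpolyXE_id rmorph_prod mdegE /=.
pose K (p : {poly {mpoly F[k]}}) n a := (size p <= n.+1)%N /\ p`_n = a%:MP_[k].
have KM p n a p' n' a' : K p n a -> K p' n' a' -> K (p * p') (n + n')%N (a * a').
  move=> [h1 h2] [h1' h2']; split; last by rewrite coefM_top // h2 h2' mpolyCM.
  by apply: leq_trans (size_polyMleq _ _) _; move: h1 h1'; lia.
have K0 : K 1 0%N 1 by split; rewrite ?size_poly1 ?coef1.
elim/big_ind3: _ => // [p a b p' a' b'|i _]; first exact: KM.
have K1 : K (shear 'X_i) 1%N (last_or 1 c i).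
  rewrite shearX /shear_var; elim/ord_lastP: i => [i|]; rewrite ?last_orW ?last_or_max.
    split; last by rewrite coefD coefC coefZ coefX add0r mulr1.
    apply: leq_trans (size_polyD _ _) _; rewrite geq_max.
    apply/andP; split; first exact: leq_trans (size_polyC_leq1 _) _.
    by apply: leq_trans (size_scale_leq _ _) _; rewrite size_polyX.
  by split; rewrite ?size_polyX ?coefX.
rewrite rmorphXn; elim: (x i) => [|e IH]; first by rewrite expr0.
by rewrite !exprS; apply: (KM _ 1%N _ _ e).
Qed.

Lemma shear_top_coef (N : {mpoly F[k.+1]}) :
  (size (shear N) <= msize N)%N /\
  (shear N)`_((msize N).-1) = ((shear_top N).@[c])%:MP.
Proof.
have e : shear N = \sum_(x <- msupp N) (N@_x)%:MP *: shear 'X_[x].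
  rewrite {1}[N]mpolyE rmorph_sum; apply: eq_bigr => x _ /=.
  by rewrite -mul_mpolyC rmorphM /= shearC mul_polyC.
split.
  rewrite e; apply: leq_trans (size_sum _ _ _) _; apply/bigmax_leqP_seq => x hx _.
  apply: leq_trans (size_scale_leq _ _) _; apply: leq_trans (shear_mon x).1 _.
  exact: msize_mdeg_lt.
rewrite e coef_sum /shear_top (raddf_sum (meval c)) (raddf_sum (@mpolyC k F)) /= [RHS]big_mkcond big_seq [RHS]big_seq.
apply: eq_bigr => x hx; rewrite coefZ; have := msize_mdeg_lt hx.
case: eqP => [<- _|ne h].
  rewrite (shear_mon x).2 mevalZ mevalX mpolyCM; congr (_ * _%:MP).
  by apply: eq_bigr => i _; rewrite mnmE.
rewrite nth_default ?mulr0 // (leq_trans (shear_mon x).1) //; move: h ne; case: (mmeasure _ N) => //= M; lia.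
Qed.

End Shear.

Lemma shear_top_neq0 (F : finFieldType) k (N : {mpoly F[k.+1]}) :
  N != 0 -> shear_top N != 0.
Proof.
move=> N0; have hm : mlead N \in msupp N by apply: mlead_supp.
have hd : mdeg (mlead N) = (msize N).-1 by rewrite -mlead_deg.
pose r (x : 'X_{1..k.+1}) := [multinom x (widen_ord (leqnSn k) i) | i < k].
have inj x : mdeg x = (msize N).-1 -> r x = r (mlead N) -> x = mlead N.
  move=> hx e; have e' i : x (widen_ord (leqnSn k) i) = (mlead N) (widen_ord (leqnSn k) i).
    by have := congr1 (fun y : 'X_{1..k} => y i) e; rewrite /r !mnmE.
  apply/mnmP; apply: ord_lastP => // .
  have := hx; rewrite -hd !mdegE !big_ord_recr /= (eq_bigr _ (fun i _ => e' i)).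
  by move/addnI.
apply/eqP => /(congr1 (mcoeff (r (mlead N)))); rewrite mcoeff0 raddf_sum /=.
rewrite -big_filter (bigD1_seq (mlead N)) ?mem_filter ?filter_uniq ?msupp_uniq ?hd ?eqxx //=.
rewrite mcoeffZ mcoeffX eqxx mulr1.
rewrite big1_seq ?addr0 => [/eqP|x /andP[nx]]; first by rewrite mcoeff_eq0 hm.
rewrite mem_filter => /andP[/eqP hx _].
rewrite mcoeffZ mcoeffX; case: eqP => [/(inj _ hx) e|]; rewrite ?mulr0 //.
by rewrite e eqxx in nx.
Qed.

Lemma shear_monic (F : finFieldType) k (N : {mpoly F[k.+1]}) :
  N != 0 -> (msize N <= #|F|)%N ->
  exists (c : 'I_k -> F) (a : F) (N' : {poly {mpoly F[k]}}),
    [/\ a != 0, N' \is monic & shear c N = a%:MP *: N'].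
Proof.
move=> N0 hN; have sN : (0 < msize N)%N by rewrite lt0n msize_poly_eq0.
have [|c hc] := mpoly_nonroot (shear_top_neq0 N0).
  apply: leq_trans hN; apply: leq_trans (msize_sum _ _ _) _.
  apply/bigmax_leqP_seq => x hx _; apply: leq_trans (msize_mdeg_lt hx).
  have [->|?] := eqVneq N@_x 0; first by rewrite scale0r msize0.
  rewrite msizeZ // msizeX ltnS !mdegE big_ord_recr /=.
  by under eq_bigr do rewrite mnmE; apply: leq_addr.
exists c; set a := (shear_top N).@[c] in hc; exists a, (a^-1%:MP *: shear c N).
have aV : a%:MP_[k] * (a^-1)%:MP = 1 by rewrite -mpolyCM mulfV.
split=> //; last by rewrite scalerA aV scale1r.
have [h1 h2] := shear_top_coef c N.
have sz : size (a^-1%:MP *: shear c N) = msize N.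
  apply/eqP; rewrite eqn_leq (leq_trans (size_scale_leq _ _)) //=.
  rewrite -(prednK sN) ltnNge; apply/negP => /leq_sizeP/(_ _ (leqnn _))/eqP.
  by rewrite coefZ h2 -/a mulrC aV oner_eq0.
by rewrite monicE lead_coefE sz coefZ h2 -/a mulrC aV.
Qed.

Section Good.
Variables (F : finFieldType) (m : nat).
Local Notation S := {mpoly F[m]}.
Implicit Types (gs : seq S) (g : S).

Definition nzd gs g : Prop := forall u, ideal gs (g * u) -> ideal gs u.

Definition flat_regular k gs : Prop :=
  regular gs /\ exists2 L : k.-tuple S, linear_forms L & flat (comp_mpoly L) gs.

Lemma flat_regular_nil : flat_regular m [::].
Proof.
split=> //; exists [tuple 'X_i | i < m].
  by apply/forallP => i; rewrite tnth_mktuple msizeX mdeg1.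
have -> : comp_mpoly [tuple 'X_i | i < m] = idfun :> (S -> S).
  by apply: funext => p; apply: comp_mpoly_id.
exact: flat_id.
Qed.

Lemma nzd_exp gs g e : nzd gs g -> nzd gs (g ^+ e).
Proof.
move=> h; elim: e => [|e IH] u; first by rewrite expr0 mul1r.
by rewrite exprS -mulrA => /h/IH.
Qed.

Lemma nzd_annihilator gs g n (f : 'I_n -> S) (t0 : 'I_n) : nzd gs g ->
  (forall t : 'I_n, (t < t0)%N -> f t = 0) ->
  ideal gs (\sum_t f t * g ^+ t) -> ideal (g :: gs) (f t0).
Proof.
move=> hg h0 hI.
exists (- \sum_(t < n | (t0 < t)%N) f t * g ^+ (t - t0).-1).
apply: (nzd_exp (e := t0) hg); move: hI; congr ideal.
rewrite (bigD1 t0) //= mulNr opprK mulrDr [g ^+ _ * f _]mulrC; congr (_ + _).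
rewrite mulr_suml mulr_sumr (bigID (fun t : 'I_n => (t < t0)%N)) /= big1 ?add0r.
  apply: eq_big => [t|t /andP[ne hn]].
    by rewrite -val_eqE /= -leqNgt ltn_neqAle eq_sym.
  have -> : g ^+ t = g ^+ t0 * (g ^+ (t - t0).-1 * g).
    by rewrite -exprSr -exprD; congr (_ ^+ _); move: ne hn; rewrite -val_eqE /=; lia.
  by ring.
by move=> t /andP[_ h]; rewrite h0 // mul0r.
Qed.

(* Elements killed by g0 + p t for distinct t are eigenvectors of g0 for
   distinct eigenvalues, hence independent over the polynomial ring. *)
Lemma zero_divisor_count gs ds k (L : k.-tuple S) (T : finType) (p : T -> {mpoly F[k]}) g0 :
  bounded_by gs ds -> regular gs -> linear_forms L -> flat (comp_mpoly L) gs ->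
  (k + size gs = m)%N -> injective p ->
  (forall t, ~ nzd gs (g0 + (p t \mPo L))) -> (#|T| <= \prod_(d <- ds) d)%N.
Proof.
move=> hb reg hL fl hm inj bad.
have ex t : exists w, ideal gs ((g0 + (p t \mPo L)) * w) /\ ~ ideal gs w.
  by have := bad t; rewrite -existsNE => -[w /not_implyP[h1 h2]]; exists w.
have [w hw] := choice ex.
apply: (rank_bound (w := w) hb reg hL hm) => r hr t.
have gen (s : seq T) : uniq s ->
    forall r : T -> {mpoly F[k]}, ideal gs (\sum_(t <- s) (r t \mPo L) * w t) ->
    forall t, t \in s -> r t = 0.
  elim: s => // x s IH /= /andP[xs us] r' hI.
  have hs t' : t' \in s -> r' t' = 0.
    have hI' : ideal gs (\sum_(t <- s) ((r' t * (p x - p t)) \mPo L) * w t).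
      rewrite big_cons in hI.
      have h1 := idealM (g0 + (p x \mPo L)) hI.
      have h2 : ideal gs (\sum_(t <- x :: s) (r' t \mPo L) * ((g0 + (p t \mPo L)) * w t)).
        by apply: ideal_sum => y _; apply: idealM; apply: (hw y).1.
      have := idealB h1 h2; congr ideal; rewrite big_cons mulrDr mulrCA opprD addrACA subrr add0r.
      rewrite mulr_sumr -sumrB; apply: eq_bigr => i _.
      by rewrite rmorphM rmorphB /=; ring.
    move=> ht; have /eqP := IH us _ hI' t' ht.
    rewrite mulf_eq0 subr_eq0 => /orP[/eqP //|/eqP/inj e].
    by rewrite e ht in xs.
  move=> t'; rewrite inE => /orP[/eqP ->|]; last exact: hs.
  apply/eqP; apply: contraT => nz; case: (hw x) => _ [].
  apply: (flat_torsion_free (phi := comp_mpoly L) fl nz).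
  move: hI; rewrite big_cons big1_seq ?addr0 // => i /andP[_ hi].
  by rewrite hs // comp_mpoly0 mul0r.
apply: (gen (enum T)); rewrite ?enum_uniq ?mem_enum //.
by rewrite big_enum.
Qed.

Lemma ideal_root gs p (z : 'I_m -> F) :
  (forall g, g \in gs -> g.@[z] = 0) -> ideal gs p -> p.@[z] = 0.
Proof.
elim: gs p => [p _ ->|g gs IH p h [u hu]]; first by rewrite meval0.
rewrite -(subrK (u * g) p) mevalD mevalM (h g) ?mem_head // mulr0 addr0.
by apply: IH hu => g' hg'; apply: h; rewrite inE hg' orbT.
Qed.

Lemma msize_prod_leq (T : finType) (A : {set T}) (p : T -> S) :
  (forall t, (msize (p t) <= 2)%N) -> (msize (\prod_(t in A) p t)%R <= #|A|.+1)%N.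
Proof.
move=> h; rewrite -sum1_card.
elim/big_ind2: _ => [|u a u' b hu hu'|t _] //; first by rewrite msizeC oner_neq0.
exact: msize_mul_leq.
Qed.

Lemma lagrange (Z : {set {ffun 'I_m -> F}}) z : exists w : S,
  [/\ (msize w <= #|Z :\ z|.+1)%N, w.@[z] != 0
    & forall z', z' \in Z -> z' != z -> w.@[z'] = 0].
Proof.
have sep (z' : {ffun 'I_m -> F}) : exists w : S, (msize w <= 2)%N /\
    (z' != z -> w.@[z] != 0 /\ w.@[z'] = 0).
  have [->|ne] := eqVneq z' z; first by exists 0; rewrite msize0.
  have /existsP[i hi] : [exists i, z i != z' i].
    apply: contraNT ne; rewrite negb_exists => /forallP h.
    by apply/eqP/ffunP => i; apply/esym/eqP; have := h i; rewrite negbK.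
  exists ('X_i - (z' i)%:MP); split=> [|_].
    apply: leq_trans (msizeD_le _ _) _.
    by rewrite msizeN msizeX mdeg1 msizeC geq_max; case: (_ == _).
  by rewrite !mevalB !mevalXU !mevalC subr_eq0 subrr.
have [w hw] := choice sep.
exists (\prod_(z' in Z :\ z) w z'); split.
- by apply: msize_prod_leq => z'; case: (hw z').
- rewrite rmorph_prod; apply/prodf_neq0 => z'; rewrite !inE => /andP[ne _].
  by case: (hw z') => _ /(_ ne)[].
move=> z' hz' ne; rewrite rmorph_prod (bigD1 z') ?inE ?hz' ?ne //=.
by case: (hw z') => _ /(_ ne)[_ ->]; rewrite mul0r.
Qed.

Lemma bezout gs ds (Z : {set {ffun 'I_m -> F}}) :
  bounded_by gs ds -> regular gs -> size gs = m ->
  (forall z g, z \in Z -> g \in gs -> g.@[z] = 0) -> (#|Z| <= \prod_(d <- ds) d)%N.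
Proof.
move=> hb reg hm hZ.
have [w hw] := choice (lagrange Z).
have hL : linear_forms ([tuple] : 0.-tuple S) by apply/forallP => -[].
have := @rank_bound F m gs ds 0 [tuple] 'I_#|Z| (fun t => w (enum_val t)) hb reg hL hm.
rewrite card_ord; apply=> p hI t.
have := ideal_root (z := enum_val t) (fun g hg => hZ _ g (enum_valP t) hg) hI.
have [_ w1 _] := hw (enum_val t).
rewrite raddf_sum (bigD1 t) //= big1 ?addr0 => [|t' ne]; last first.
  have [_ _ w0] := hw (enum_val t').
  by rewrite mevalM w0 ?enum_valP ?mulr0 // (inj_eq enum_val_inj) eq_sym.
rewrite [p t]nvar0_mpolyC comp_mpolyC mevalM mevalC => /eqP.
by rewrite mulf_eq0 (negPf w1) orbF => /eqP ->; rewrite mpolyC0.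
Qed.

End Good.

Lemma flat_regular_cons m Pi d : exists q0, forall (F : finFieldType) (gs : seq {mpoly F[m]}) ds k g, (q0 <= #|F|)%N ->
  bounded_by gs ds -> (\prod_(e <- ds) e = Pi)%N -> (k.+1 + size gs = m)%N ->
  (msize g <= d.+1)%N -> nzd gs g -> flat_regular k.+1 gs -> flat_regular k (g :: gs).
Proof.
have [M hM] := @bounded_relation m Pi (Pi * d).
exists M.+1 => F gs ds k g hq hb hPi hm hg hnz [reg [L hL fl]].
split=> //.
have [||p [hp hI [t1 ht1]]] := hM F gs ds k.+1 L 'I_Pi.+1 (fun t => g ^+ t) hb reg hL hm hPi.
- by rewrite card_ord.
- move=> t; apply: (@leq_trans (t * d).+1); last by rewrite ltnS leq_mul2r -ltnS ltn_ord orbT.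
  elim: (t : nat) => [|e IH]; first by rewrite expr0 msizeC oner_neq0.
  by rewrite exprS mulSn; apply: msize_mul_leq.
pose t0 := [arg min_(t < t1 | p t != 0) t].
have [N0 min0] : p t0 != 0 /\ forall t : 'I_Pi.+1, (t < t0)%N -> p t = 0.
  rewrite /t0; case: arg_minnP => // t ht hmin; split=> // t' lt.
  by apply/eqP; apply: contraLR lt => /hmin; rewrite -leqNgt.
have hN : ideal (g :: gs) (p t0 \mPo L).
  apply: (nzd_annihilator (f := fun t => p t \mPo L)) hnz _ hI => t lt.
  by rewrite min0 // comp_mpoly0.
have [c [a [N' [a0 mN' eN']]]] := shear_monic N0 (leq_trans (hp t0) hq).
pose Lmax := tnth L ord_max.
pose L' := [tuple tnth L (widen_ord (leqnSn k) i) - (c i)%:MP * Lmax | i < k] : k.-tuple {mpoly F[m]}.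
have hL' : linear_forms L'.
  apply/forallP => i; rewrite tnth_mktuple; apply: leq_trans (msizeD_le _ _) _.
  rewrite msizeN geq_max (forallP hL) /=.
  apply: (@msize_mul_leq _ _ _ _ 0 1); last exact: (forallP hL).
  by rewrite msizeC; case: (_ == _).
exists L' => //.
pose psi := horner_eval Lmax \o map_poly (comp_mpoly L').
have psiE q : psi (shear c q) = q \mPo L.
  apply: (@eq_mpoly_rmorph _ _ _ (psi \o shear c) (comp_mpoly L)) => [b|i].
    by rewrite /= shearC /psi /= map_polyC /= comp_mpolyC horner_evalE hornerC comp_mpolyC.
  rewrite /= shearX /shear_var comp_mpolyXU -tnth_nth /psi /= horner_evalE.
  elim/ord_lastP: i => [i|]; rewrite ?last_orW ?last_or_max; last by rewrite map_polyX hornerX.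
  rewrite rmorphD /= map_polyZ map_polyC map_polyX /= comp_mpolyXU comp_mpolyC.
  by rewrite -tnth_nth tnth_mktuple hornerD hornerC hornerZ hornerX subrK.
have fpsi : flat psi gs by apply: (flat_surj (shear_surj c) psiE fl).
have -> : comp_mpoly L' = psi \o polyC.
  by apply: funext => q; rewrite /psi /= map_polyC horner_evalE hornerC.
suff hpsi : ideal (g :: gs) (psi N') by apply: flat_step mN' hpsi.
have -> : psi N' = psi (a^-1)%:MP%:P * psi (shear c (p t0)).
  rewrite -rmorphM eN' -mul_polyC mulrA -polyCM -mpolyCM mulVf // mul1r //.
by apply: idealM; rewrite psiE.
Qed.

(** * Random polynomials *)

Lemma card_fiber_preim (V W : finType) (g : V -> W) (B : {set W}) :
  (forall w w', exists h : V -> V, injective h /\ forall v, g v = w -> g (h v) = w') ->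
  (#|[set v | g v \in B]| * #|W| = #|B| * #|V|)%N.
Proof.
move=> tr; pose fib w := [set v | g v == w].
have le w w' : (#|fib w| <= #|fib w'|)%N.
  have [h [hi hg]] := tr w w'; rewrite -(card_imset _ hi); apply: subset_leq_card.
  by apply/subsetP => _ /imsetP[v + ->]; rewrite !inE => /eqP/hg/eqP.
have eqf w w' : #|fib w| = #|fib w'| by apply/eqP; rewrite eqn_leq !le.
have sumB (C : {set W}) : #|[set v | g v \in C]| = (\sum_(w in C) #|fib w|)%N.
  rewrite -sum1_card (partition_big g (mem C)) /= => [|v]; last by rewrite inE.
  apply: eq_bigr => w hw; rewrite -sum1_card; apply: eq_bigl => v; rewrite !inE.
  by case: eqP => [->|]; rewrite ?hw ?andbF.
have [w0|no] := pickP (mem [set: W]); last first.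
  have W0 : #|W| = 0%N by apply: eq_card0 => w; have := no w; rewrite /= in_setT.
  have V0 : #|V| = 0%N by apply: eq_card0 => v; have := no (g v); rewrite /= in_setT.
  by rewrite W0 V0 !muln0.
have sumC (C : {set W}) : #|[set v | g v \in C]| = (#|C| * #|fib w0|)%N.
  by rewrite sumB (eq_bigr (fun _ => #|fib w0|)) ?sum_nat_const // => w _; apply: eqf.
have -> : #|V| = #|[set v | g v \in [set: W]]|.
  by rewrite -cardsT; apply: eq_card => v; rewrite !inE.
by rewrite !sumC cardsT -mulnA [(#|fib _| * _)%N]mulnC.
Qed.

Lemma card_tuple_cons (T : finType) N (P : pred (N.+1.-tuple T)) :
  #|[set t | P t]| = (\sum_(h : T) #|[set t : N.-tuple T | P [tuple of h :: t]]|)%N.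
Proof.
rewrite -sum1_card.
rewrite (reindex (fun p : T * N.-tuple T => [tuple of p.1 :: p.2])) /=; last first.
  exists (fun t => (thead t, [tuple of behead t])) => [[h t]|t] _ /=.
    by congr pair; apply: val_inj.
  by rewrite -tuple_eta.
under eq_bigl do rewrite inE.
rewrite -(pair_big_dep xpredT (fun (h : T) (t : N.-tuple T) => P [tuple of h :: t]) (fun _ _ => 1%N)) /=.
by apply: eq_bigr => h _; rewrite -sum1_card; apply: eq_bigl => t; rewrite inE.
Qed.

Lemma card_all_tuple (T : finType) N (P : pred T) :
  #|[set t : N.-tuple T | all P t]| = (#|[set x | P x]| ^ N)%N.
Proof.
elim: N => [|N IH].
  rewrite expn0 -[RHS](card_tuple 0 T) -cardsT; apply: eq_card => t.
  by rewrite !inE tuple0.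
rewrite card_tuple_cons expnS -IH -sum_nat_const [RHS]big_mkcond /=.
apply: eq_bigr => h _; rewrite inE; case: (boolP (P h)) => hP /=.
  by apply: eq_card => t; rewrite !inE.
by apply: eq_card0 => t; rewrite !inE.
Qed.

Section Pol.
Variables (F : finFieldType) (m : nat).
Local Notation q := #|F|.

Definition pt := {ffun 'I_m -> F}.
Definition pol d := {ffun 'X_{1..m < d.+1} -> F}.
HB.instance Definition _ := Finite.on pt.
HB.instance Definition _ := GRing.Zmodule.on pt.
HB.instance Definition _ d := Finite.on (pol d).
HB.instance Definition _ d := GRing.Zmodule.on (pol d).

Definition topoly d (c : pol d) : {mpoly F[m]} := \sum_x c x *: 'X_[val x].
Definition frompoly d (p : {mpoly F[m]}) : pol d := [ffun x => p@_(val x)].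
Definition ev d (c : pol d) (z : pt) : F := (topoly c).@[z].

Lemma topolyD d (c c' : pol d) : topoly (c + c') = topoly c + topoly c'.
Proof. by rewrite /topoly -big_split; apply: eq_bigr => x _; rewrite ffunE scalerDl. Qed.

Lemma evD d (c c' : pol d) z : ev (c + c') z = ev c z + ev c' z.
Proof. by rewrite /ev topolyD mevalD. Qed.

Lemma evE d (c : pol d) z : ev c z = \sum_x c x * ('X_[val x]).@[z].
Proof. by rewrite /ev /topoly rmorph_sum; apply: eq_bigr => x _; rewrite /= mevalZ. Qed.

Lemma msize_topoly d (c : pol d) : (msize (topoly c) <= d.+1)%N.
Proof.
apply: leq_trans (msize_sum _ _ _) _; apply/bigmax_leqP_seq => x _ _.
have [->|?] := eqVneq (c x) 0; first by rewrite scale0r msize0.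
by rewrite msizeZ // msizeX; apply: bmdeg.
Qed.

Lemma frompolyK d (p : {mpoly F[m]}) : (msize p <= d.+1)%N -> topoly (frompoly d p) = p.
Proof.
move=> hp; rewrite {2}(mpolywE hp) /topoly.
by apply: eq_bigr => x _; rewrite ffunE.
Qed.

Lemma card_pol d : #|{: pol d}| = (q ^ tau m d)%N.
Proof. by rewrite card_ffun card_bmnm. Qed.

Lemma card_pt : #|{: pt}| = (q ^ m)%N.
Proof. by rewrite card_ffun card_ord. Qed.

Lemma card_zero_divisors gs ds k d :
  bounded_by gs ds -> flat_regular k gs -> (k + size gs = m)%N ->
  (#|[set c : pol d | ~~ `[< nzd gs (topoly c) >]]| * q ^ tau k d <=
   (\prod_(e <- ds) e) * #|{: pol d}|)%N.
Proof.
move=> hb [reg [L hL fl]] hm.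
set bad := [set c | _].
pose H := {ffun 'X_{1..k < d.+1} -> F}.
pose hp (h : H) : {mpoly F[k]} := \sum_x h x *: 'X_[val x].
have hpi : injective hp.
  move=> h h' e; apply/ffunP => y.
  have co (l : H) : (hp l)@_(val y) = l y.
    rewrite raddf_sum (bigD1 y) //= mcoeffZ mcoeffX eqxx mulr1 big1 ?addr0 // => z nz.
    by rewrite mcoeffZ mcoeffX; case: eqP => [/val_inj /eqP|]; rewrite ?(negPf nz) ?mulr0.
  by rewrite -!co e.
have hps h : (msize (hp h \mPo L) <= d.+1)%N.
  apply: leq_trans (msize_comp _ hL) _.
  apply: leq_trans (msize_sum _ _ _) _; apply/bigmax_leqP_seq => x _ _.
  have [->|?] := eqVneq (h x) 0; first by rewrite scale0r msize0.
  by rewrite msizeZ // msizeX; apply: bmdeg.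
pose sh (h : H) : pol d := frompoly d (hp h \mPo L).
have cH : (q ^ tau k d)%N = #|{: H}| by rewrite card_ffun card_bmnm.
rewrite cH mulnC.
have -> : (#|{: H}| * #|bad| = \sum_(c : pol d) #|[set h | (c + sh h)%R \in bad]|)%N.
  have -> : (\sum_(c : pol d) #|[set h | (c + sh h)%R \in bad]| =
             \sum_(c : pol d) \sum_(h : H) ((c + sh h)%R \in bad : nat))%N.
    apply: eq_bigr => c _; rewrite -sum1_card big_mkcond /=.
    by apply: eq_bigr => h _; rewrite inE; case: (_ \in _).
  rewrite exchange_big /= -sum_nat_const; apply: eq_bigr => h _.
  rewrite -sum1_card big_mkcond /= (reindex_inj (addIr (sh h))) /=.
  by apply: eq_bigr => c _; case: (_ \in _).
rewrite mulnC -sum_nat_const; apply: leq_sum => c _.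
rewrite -[#|_|]card_ord.
pose hh (i : 'I_#|[set h | (c + sh h)%R \in bad]|) : H := enum_val i.
apply: (zero_divisor_count (L := L) (p := fun i => hp (hh i)) (g0 := topoly c) hb reg hL fl hm).
  by move=> i j /hpi/enum_val_inj.
move=> i hn; have := enum_valP i; rewrite !inE => /negP; apply.
by apply/asboolP; rewrite topolyD frompolyK.
Qed.

End Pol.

Lemma leq_tau_l j j' d : (j <= j')%N -> (tau j d <= tau j' d)%N.
Proof.
move=> h; rewrite -(subnK h); elim: (j' - j)%N => // i IH.
apply: leq_trans IH _; rewrite addSn; case: d => [|d]; first by rewrite !tau_n0.
by rewrite tauS leq_addl.
Qed.

Lemma bounded_cons (F : finFieldType) m d (gs : seq {mpoly F[m]}) ds (c : pol F m d) :
  (0 < d)%N -> bounded_by gs ds -> bounded_by (topoly c :: gs) (d :: ds).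
Proof. by move=> d0 h; rewrite /= msize_topoly d0. Qed.

Definition extend (F : finFieldType) m d (gs : seq {mpoly F[m]}) (t : seq (pol F m d)) :=
  catrev (map (@topoly F m d) t) gs.

Lemma card_not_flat_regular m d N Pi : (0 < d)%N -> exists q0 C, forall (F : finFieldType) (gs : seq {mpoly F[m]}) ds k,
  (q0 <= #|F|)%N -> bounded_by gs ds -> (\prod_(e <- ds) e = Pi)%N ->
  (k + N + size gs = m)%N -> flat_regular (k + N) gs ->
  (#|[set t : N.-tuple (pol F m d) | ~~ `[< flat_regular k (extend gs t) >]]| * #|F| ^ tau k.+1 d
   <= C * #|{: pol F m d}| ^ N)%N.
Proof.
move=> d0; elim: N Pi => [|N IH] Pi.
  exists 0%N, 0%N => F gs ds k _ _ _ _; rewrite addn0 => hgood.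
  rewrite eq_card0 // => t; rewrite !inE tuple0; apply/negbTE; rewrite negbK.
  exact/asboolP.
have [q0 [C hC]] := IH (d * Pi)%N; have [q1 hq1] := flat_regular_cons m Pi d.
exists (maxn q0 q1), (Pi + C)%N => F gs ds k; rewrite geq_max => /andP[hq0 hq1'] hb hPi hm hgood.
rewrite card_tuple_cons big_distrl /=.
set V := pol F m d; set bad := [set c : V | ~~ `[< nzd gs (topoly c) >]].
rewrite (bigID (mem bad)) /= mulnDl; apply: leq_add; last first.
  apply: (@leq_trans (\sum_(c : V | c \notin bad) C * #|{: V}| ^ N)).
    apply: leq_sum => c; rewrite inE negbK => /asboolP hn.
    apply: (hC F (topoly c :: gs) (d :: ds) k hq0).
    - exact: bounded_cons.
    - by rewrite big_cons hPi.
    - by apply: etrans hm; rewrite /= addnS -addSn addnS.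
    apply: (hq1 F gs ds (k + N)%N (topoly c)) => //.
    - by apply: etrans hm; rewrite addnS.
    - exact: msize_topoly.
    - by rewrite -addnS.
  rewrite sum_nat_const expnS mulnCA leq_mul2l; apply/orP; right.
  by rewrite leq_mul2r max_card orbT.
apply: (@leq_trans (\sum_(c in bad) #|{: V}| ^ N * #|F| ^ tau (k + N.+1) d)).
  apply: leq_sum => c _; apply: leq_mul.
    by rewrite -card_tuple; apply: leq_trans (max_card _) _.
  rewrite leq_exp2l ?leq_tau_l //; first by lia.
  exact: card_finRing_gt1.
rewrite sum_nat_const mulnCA expnS [leqRHS]mulnA [leqRHS]mulnC leq_mul2l; apply/orP; right.
by rewrite -hPi; apply: card_zero_divisors.
Qed.

(** * Independent conditions on cubics *)

Section Partition.
Variables (K : fieldType) (V : vectType K) (T : finType) (v : T -> V).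
Implicit Types (A B E : {set T}).

Definition vspan A : {vspace V} := (\sum_(i in A) <[v i]>)%VS.

Lemma vspan0 : vspan set0 = 0%VS.
Proof. by rewrite /vspan big_set0. Qed.

Lemma vspan1 i : vspan [set i] = <[v i]>%VS.
Proof. by rewrite /vspan big_set1. Qed.

Lemma vspanU A B : [disjoint A & B] -> vspan (A :|: B) = (vspan A + vspan B)%VS.
Proof. by move=> h; rewrite /vspan -bigU //; apply: eq_bigl => i; rewrite !inE. Qed.

Lemma vspanS A B : A \subset B -> (vspan A <= vspan B)%VS.
Proof.
move=> h; apply/subv_sumP => i hi; apply: sumv_sup (subvv _).
exact: (subsetP h).
Qed.

Lemma dim_vspan A : (\dim (vspan A) <= #|A|)%N.
Proof.
apply: leq_trans (dimv_leq_sum _ _ _) _; rewrite -sum1_card; apply: leq_sum => i _.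
by rewrite dim_vline leq_b1.
Qed.

Lemma dimv_submod (U U' X : {vspace V}) : (U <= U')%VS ->
  (\dim (U' + X) + \dim U <= \dim (U + X) + \dim U')%N.
Proof.
move=> h; have := dimv_sum_cap U' (U + X)%VS.
rewrite addvA (addv_idPl h) => e; rewrite [leqRHS]addnC -e leq_add2l.
by apply: dimvS; rewrite subv_cap h addvSl.
Qed.

(* Edmonds' matroid partition theorem for the linear matroids V / W j. *)
Lemma matroid_partition (J : finType) (j0 : J) E (W : J -> {vspace V}) :
  (forall A, A \subset E ->
     (#|A| + \sum_j \dim (W j) <= \sum_j \dim (W j + vspan A))%N) ->
  exists f : T -> J, forall j,
    \dim (W j + vspan [set i in E | f i == j]) =
    (\dim (W j) + #|[set i in E | f i == j]|)%N.
Proof.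
have [n] := ubnP #|E|; elim: n E W => // n IH E W ltE cond.
have [E0|[e eE]] := set_0Vmem E.
  exists (fun=> j0) => j.
  have -> : [set i in E | j0 == j] = set0 by apply/setP => i; rewrite E0 !inE.
  by rewrite vspan0 addv0 cards0 addn0.
have [/existsP[A /and4P[AE A0 AnE tight]]|no] := boolP [exists A : {set T},
    [&& A \subset E, A != set0, A != E
      & #|A| + \sum_j \dim (W j) == \sum_j \dim (W j + vspan A)]%N].
  have cA : (#|A| < #|E|)%N by apply: proper_card; rewrite properEneq AnE.
  have [|f1 h1] := IH A W _ (fun B hB => cond B (subset_trans hB AE)).
    by apply: leq_trans cA _; rewrite -ltnS.
  pose C := E :\: A; pose W' j := (W j + vspan A)%VS.
  have cC : (#|C| < #|E|)%N.
    have := subset_leq_card AE; rewrite /C cardsD (setIidPr AE).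
    by move: A0; rewrite -card_gt0; lia.
  have [||f2 h2] := IH C W'.
  - by apply: leq_trans cC _; rewrite -ltnS.
  - move=> B hB; have dAB : [disjoint A & B].
      by rewrite disjoint_sym disjoints_subset (subset_trans hB) // subsetDr.
    have hAB : A :|: B \subset E by rewrite subUset AE (subset_trans hB) ?subsetDl.
    have := cond _ hAB; rewrite cardsU (disjoint_setI0 dAB) cards0 subn0.
    rewrite [(#|A| + _)%N]addnC -addnA (eqP tight).
    by under [X in (_ <= X)%N]eq_bigr do rewrite vspanU // addvA.
  exists (fun i => if i \in A then f1 i else f2 i) => j.
  set Ej := [set i in E | _].
  set A1 := [set i in A | f1 i == j] in h1.
  have /= hj1 := h1 j; have /= hj2 := h2 j.
  set Aj := [set i in A | f1 i == j] in hj1; set Cj := [set i in C | f2 i == j] in hj2.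
  have dAC : [disjoint Aj & Cj].
    rewrite -setI_eq0; apply/eqP/setP => i; rewrite !inE.
    by case: (i \in A); rewrite ?andbF.
  have eE' : Ej = Aj :|: Cj.
    apply/setP => i; rewrite !inE; case: (boolP (i \in A)) => [hi|]; rewrite /= ?orbF //.
    by rewrite (subsetP AE).
  rewrite eE' vspanU // addvA cardsU (disjoint_setI0 dAC) cards0 subn0 addnA -hj1.
  apply/eqP; rewrite eqn_leq; apply/andP; split.
    by apply: leq_trans (dimv_add_leqif _ _) _; rewrite leq_add2l dim_vspan.
  have sub : (W j + vspan Aj <= W' j)%VS.
    by apply: addvS => //; apply: vspanS; apply/subsetP => i; rewrite inE => /andP[].
  have := dimv_submod (vspan Cj) sub; rewrite hj2; lia.
have := cond [set e]; rewrite sub1set eE cards1 => /(_ isT) ce.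
have [j hj] : exists j, v e \notin W j.
  apply/existsP; apply: contraLR ce => /existsPn h; rewrite -ltnNge add1n ltnS.
  apply: leq_sum => j _; have := h j; rewrite negbK vspan1 => hv.
  by have /addv_idPl -> : (<[v e]> <= W j)%VS by rewrite -memvE.
pose W' i := if i == j then (W i + <[v e]>)%VS else W i.
have ve0 : v e != 0 by apply: contra hj => /eqP ->; rewrite mem0v.
have dW' : \dim (W j + <[v e]>) = (\dim (W j)).+1.
  rewrite dimv_disjoint_sum ?dim_vline ?ve0 ?addn1 //.
  apply/eqP; rewrite -subv0; apply/subvP => x; rewrite memv_cap => /andP[hx /vlineP[k ex]].
  rewrite memv0 ex; have [->|k0] := eqVneq k 0; first by rewrite scale0r.
  by case/negP: hj; rewrite -[v e]scale1r -(mulVf k0) -scalerA -ex memvZ.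
have sW' : (\sum_i \dim (W' i) = (\sum_i \dim (W i)).+1)%N.
  rewrite (bigD1 j) //= [in RHS](bigD1 j) //= /W' eqxx dW' addSn; congr (_ + _).+1.
  by apply: eq_bigr => i /negPf ->.
have [||f hf] := IH (E :\ e) W'.
- by move: ltE; rewrite (cardsD1 e E) eE add1n ltnS.
- move=> A AE; have [->|A0] := eqVneq A set0.
    by rewrite cards0 vspan0; under [leqRHS]eq_bigr do rewrite addv0.
  have AE' : A \subset E by apply: subset_trans AE (subsetDl _ _).
  have AnE : A != E.
    by apply: contraTneq AE => ->; apply/subsetPn; exists e => //; rewrite !inE eqxx.
  rewrite sW' addnS; apply: (@leq_trans (\sum_i \dim (W i + vspan A))).
    rewrite ltn_neqAle cond // andbT.
    by have /existsPn/(_ A) := no; rewrite AE' A0 AnE /=.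
  apply: leq_sum => i _; apply: dimvS; apply: addvS => //.
  by rewrite /W'; case: eqP => // _; apply: addvSl.
exists (fun i => if i == e then j else f i) => i.
have [->|ne] := eqVneq i j; last first.
  have := hf i; rewrite /W' (negPf ne).
  suff -> : [set i0 in E :\ e | f i0 == i] = [set i0 in E | (if i0 == e then j else f i0) == i] by [].
  by apply/setP => t; rewrite !inE; case: (eqVneq t e) => //= _; rewrite eq_sym (negPf ne) andbF.
have := hf j; rewrite /W' eqxx dW'.
set B := [set i0 in E :\ e | _].
have -> : [set i0 in E | (if i0 == e then j else f i0) == j] = e |: B.
  by apply/setP => t; rewrite !inE; case: (eqVneq t e) => [->|] //=; rewrite eqxx eE.
have eB : e \notin B by rewrite !inE eqxx.
rewrite cardsU1 eB add1n addnS -addSn => <-.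
by rewrite vspanU ?vspan1 ?addvA // disjoints1.
Qed.

Lemma vspan_free A : \dim (vspan A) = #|A| -> free [seq v i | i <- enum A].
Proof.
move=> h; rewrite /free span_def big_map big_enum /= -/(vspan A) h.
by rewrite size_map -cardE.
Qed.

Lemma free_functional (X : seq V) : free X ->
  exists2 l : V -> K, scalar l & forall x, x \in X -> l x = 1.
Proof.
move=> fX; pose Xt := in_tuple X.
exists (fun x => \sum_(i < size X) coord Xt i x) => [k x y|x /(nthP 0)[i hi <-]].
  by rewrite mulr_sumr -big_split; apply: eq_bigr => i _; rewrite linearP.
rewrite (bigD1 (Ordinal hi)) //= (coord_free (X := Xt) (Ordinal hi)) ?eqxx //.
rewrite big1 ?addr0 // => t /negPf ne.
by rewrite (coord_free (X := Xt) (Ordinal hi)) // eq_sym ne.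
Qed.

End Partition.

Lemma card_subset_between (T : finType) (I A : {set T}) n :
  I \subset A -> (#|I| <= n <= #|A|)%N ->
  exists S : {set T}, [/\ I \subset S, S \subset A & #|S| = n].
Proof.
move=> IA /andP[hI hA]; pose D := A :\: I; pose t := take (n - #|I|) (enum D).
have tD : {subset t <= D} by move=> x /mem_take; rewrite mem_enum.
have ct : #|[set x in t]| = (n - #|I|)%N.
  rewrite cardsE (card_uniqP _) ?take_uniq ?enum_uniq // size_take -cardE.
  by have := cardsD A I; rewrite (setIidPr IA) -/D; case: ifP; lia.
exists (I :|: [set x in t]); split; first exact: subsetUl.
  rewrite subUset IA; apply/subsetP => x; rewrite inE => /tD.
  by rewrite inE => /andP[].
rewrite cardsU (_ : I :&: _ = set0) ?cards0 ?subn0 ?ct ?subnKC //.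
apply/setP => x; rewrite !inE; apply/negbTE; apply/negP => /andP[xI /tD].
by rewrite inE xI.
Qed.

Section Points.
Variables (F : finFieldType) (m : nat).
Local Notation q := #|F|.
Local Notation pt := (pt F m).
Local Notation pol := (pol F m).
Implicit Types (A B S : {set pt}) (z p : pt).

Definition indep d A : bool := [forall x in A, [exists c : pol d,
  (ev c x == 1) && [forall y in A, (y != x) ==> (ev c y == 0)]]].

Lemma indepP d A : (forall x, x \in A -> exists w : {mpoly F[m]},
    [/\ (msize w <= d.+1)%N, w.@[x] != 0 & forall y, y \in A -> y != x -> w.@[y] = 0]) ->
  indep d A.
Proof.
move=> h; apply/forall_inP => x xA; have [w [hw wx wy]] := h x xA.
have hs : (msize (w.@[x]^-1 *: w) <= d.+1)%N by rewrite msizeZ ?invr_eq0.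
have evW y : ev (frompoly d (w.@[x]^-1 *: w)) y = w.@[x]^-1 * w.@[y].
  by rewrite /ev frompolyK // mevalZ.
apply/existsP; exists (frompoly d (w.@[x]^-1 *: w)); rewrite evW mulVf // eqxx.
by apply/forall_inP => y yA; apply/implyP => ne; rewrite evW (wy y) // mulr0.
Qed.

Lemma indep_sub d A B : A \subset B -> indep d B -> indep d A.
Proof.
move=> AB /forall_inP h; apply/forall_inP => x /(subsetP AB)/h/existsP[c /andP[cx cy]].
apply/existsP; exists c; rewrite cx; apply/forall_inP => y /(subsetP AB) yB.
by move/forall_inP: cy => /(_ y yB).
Qed.

Lemma indep_small d A : (#|A| <= d.+1)%N -> indep d A.
Proof.
move=> hA; apply: indepP => x xA; have [w [h1 h2 h3]] := lagrange A x.
by exists w; split=> //; apply: leq_trans h1 _; rewrite (cardsD1 x A) xA add1n in hA.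
Qed.

Lemma indep_interp d A (v : pt -> F) : indep d A ->
  exists c : pol d, forall x, x \in A -> ev c x = v x.
Proof.
move=> /forall_inP h.
have ex x : exists w : {mpoly F[m]}, x \in A ->
    [/\ (msize w <= d.+1)%N, w.@[x] = 1 & forall y, y \in A -> y != x -> w.@[y] = 0].
  have [xA|] := boolP (x \in A); last by exists 0.
  have /existsP[c /andP[/eqP cx /forall_inP cy]] := h x xA.
  exists (topoly c) => _; split=> //; first exact: msize_topoly.
  by move=> y yA ne; apply/eqP; have := cy y yA; rewrite ne.
have [w hw] := choice ex.
exists (frompoly d (\sum_(x in A) v x *: w x)) => x xA.
rewrite /ev frompolyK; last first.
  apply: leq_trans (msize_sum _ _ _) _; apply/bigmax_leqP_seq => y _ yA.
  have [->|?] := eqVneq (v y) 0; first by rewrite scale0r msize0.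
  by rewrite msizeZ //; case: (hw y yA).
rewrite rmorph_sum (bigD1 x) //= mevalZ; case: (hw x xA) => _ -> _; rewrite mulr1.
rewrite big1 ?addr0 // => y /andP[yA ne]; rewrite /= mevalZ.
by case: (hw y yA) => _ _ -> //; rewrite ?mulr0 // eq_sym.
Qed.

Definition vanish d A (c : pol d) : bool := [forall z in A, ev c z == 0].

Lemma card_vanish d A : indep d A ->
  (#|[set c : pol d | vanish A c]| * q ^ #|A| = #|{: pol d}|)%N.
Proof.
move=> iA; pose g (c : pol d) : {ffun 'I_#|A| -> F} := [ffun i => ev c (enum_val i)].
have := @card_fiber_preim (pol d) {ffun 'I_#|A| -> F} g [set [ffun=> 0]].
rewrite cards1 mul1n card_ffun card_ord => <-.
  congr (_ * _)%N; apply: eq_card => c; rewrite !inE; apply/forall_inP/eqP.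
    by move=> h; apply/ffunP => i; rewrite !ffunE; apply/eqP/h; apply: enum_valP.
  move=> /ffunP h z zA; have := h (enum_rank_in zA z).
  by rewrite !ffunE enum_rankK_in // => ->.
move=> w w'; have [c hc] := indep_interp (fun z =>
   if [pick i | enum_val i == z] is Some i then w' i - w i else 0) iA.
exists (fun v => v + c); split=> [|v hv]; first exact: addIr.
apply/ffunP => i; rewrite ffunE evD hc ?enum_valP //.
have -> : ev v (enum_val i) = w i by rewrite -hv ffunE.
case: pickP => [j /eqP/enum_val_inj ->|/(_ i)]; last by rewrite eqxx.
by rewrite addrCA subrr addr0.
Qed.

Definition vec_from p z : 'rV[F]_m := \row_i (z i - p i).

Lemma vec_from_eq0 p z : vec_from p z = 0 -> z = p.
Proof.
move=> /rowP h; apply/ffunP => i; apply/eqP; rewrite -subr_eq0.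
by have := h i; rewrite !mxE => ->.
Qed.

(* Each of three hyperplanes avoiding p covers one class of the partition. *)
Lemma cubic_separation p (E : {set pt}) :
  (forall A, A \subset E -> (#|A| <= 3 * \dim (vspan (vec_from p) A))%N) ->
  exists w : {mpoly F[m]}, [/\ (msize w <= 4)%N, w.@[p] = 1 & forall z, z \in E -> w.@[z] = 0].
Proof.
move=> cond.
have [|f hf] := @matroid_partition _ _ _ (vec_from p) 'I_3 ord0 E (fun=> 0%VS).
  move=> A /cond; rewrite !sum_nat_const card_ord dimv0 muln0 addn0.
  by rewrite add0v.
have ex j : exists l : 'rV[F]_m -> F, scalar l /\
    forall z, z \in E -> f z = j -> l (vec_from p z) = 1.
  have := hf j; rewrite add0v dimv0 add0n => /vspan_free/free_functional[l ll hl].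
  exists l; split=> // z zE fz; apply: hl; apply: map_f.
  by rewrite mem_enum inE zE fz eqxx.
have [l hl] := choice ex.
pose h j : {mpoly F[m]} := 1 - \sum_(i < m) l j (delta_mx 0 i) *: ('X_i - (p i)%:MP).
have lin j (t : 'rV[F]_m) : l j t = \sum_(i < m) l j (delta_mx 0 i) * t 0 i.
  have [ls _] := hl j.
  have l0 : l j 0 = 0 by have := ls (-1) 0 0; rewrite scaler0 addr0 mulN1r addNr.
  rewrite {1}(row_sum_delta t); elim/big_ind2: _ => // [u a u' b <- <-|i _].
    by have := ls 1 a b; rewrite scale1r mul1r.
  by have := ls (t 0 i) (delta_mx 0 i) 0; rewrite !addr0 l0 addr0 mulrC.
have hE j z : (h j).@[z] = 1 - l j (vec_from p z).
  rewrite mevalB meval1 rmorph_sum lin; congr (_ - _); apply: eq_bigr => i _ /=.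
  by rewrite mevalZ mevalB mevalXU mevalC mxE.
have hs j : (msize (h j) <= 2)%N.
  apply: leq_trans (msizeD_le _ _) _; rewrite geq_max msizeN msizeC oner_neq0 /=.
  apply: leq_trans (msize_sum _ _ _) _; apply/bigmax_leqP_seq => i _ _.
  have [->|?] := eqVneq (l j (delta_mx 0 i)) 0; first by rewrite scale0r msize0.
  rewrite msizeZ //; apply: leq_trans (msizeD_le _ _) _.
  by rewrite msizeN msizeX mdeg1 msizeC geq_max; case: (_ == _).
exists (\prod_(j in [set: 'I_3]) h j); split.
- by apply: leq_trans (msize_prod_leq _ hs) _; rewrite cardsT card_ord.
- rewrite rmorph_prod big1 // => j _ /=; rewrite hE.
  have -> : vec_from p p = 0 by apply/rowP => i; rewrite !mxE subrr.
  by have [ls _] := hl j; have := ls (-1) 0 0; rewrite scaler0 addr0 mulN1r addNr => ->; rewrite subr0.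
move=> z zE; rewrite rmorph_prod (bigD1 (f z)) ?inE //= hE.
by case: (hl (f z)) => _ ->; rewrite ?subrr ?mul0r.
Qed.

Lemma dependent_config (A : {set pt}) : ~~ indep 3 A ->
  exists (p : pt) (S I : {set pt}),
    [/\ p \in A, S \subset A, p \notin S, indep 3 S & I \subset S] /\
    [/\ (0 < #|I|)%N, #|S| = (3 * #|I|).+1 &
      forall z, z \in S -> vec_from p z \in <<[seq vec_from p x | x <- enum I]>>%VS].
Proof.
move=> hA; have [B /minsetP[nB minB] BA] := minset_exists (P := fun B => ~~ indep 3 B) hA.
have [p pB hp] : exists2 p, p \in B & ~ (exists w : {mpoly F[m]},
    [/\ (msize w <= 4)%N, w.@[p] != 0 & forall y, y \in B -> y != p -> w.@[y] = 0]).
  apply: contrapT => no; case/negP: nB; apply: indepP => x xB.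
  by apply: contrapT => hx; apply: no; exists x.
have [A' [A'E cA']] : exists A' : {set pt}, A' \subset B :\ p /\
    (3 * \dim (vspan (vec_from p) A') < #|A'|)%N.
  apply: contrapT => no; apply: hp.
  have [|w [w1 w2 w3]] := @cubic_separation p (B :\ p).
    by move=> A' hA'; rewrite leqNgt; apply/negP => h; apply: no; exists A'.
  exists w; split=> //; first by rewrite w2 oner_neq0.
  by move=> y yB ne; apply: w3; rewrite !inE ne.
have pA' : p \notin A' by apply/negP => /(subsetP A'E); rewrite !inE eqxx.
have A'B : A' \subset B by apply: subset_trans A'E (subsetDl _ _).
have iA' : indep 3 A'.
  by apply: contraT => /minB/(_ A'B) e; rewrite e pB in pA'.
pose P (I : {set pt}) := (I \subset A') && free [seq vec_from p x | x <- enum I].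
have P0 : P set0 by rewrite /P sub0set enum_set0 /= nil_free.
have [I /maxsetP[/andP[IA' fI] maxI] _] := maxset_exists P0.
have spI z : z \in A' -> vec_from p z \in <<[seq vec_from p x | x <- enum I]>>%VS.
  move=> zA'; have [zI|zI] := boolP (z \in I).
    by apply/memv_span/map_f; rewrite mem_enum.
  apply: contraT => hz; case/negP: zI.
  have <- : z |: I = I; last by rewrite setU11.
  apply: maxI; last exact: subsetUr.
  rewrite /P subUset sub1set zA' IA' /=.
  rewrite (@perm_free _ _ _ (vec_from p z :: [seq vec_from p x | x <- enum I])) ?free_cons ?hz //.
  rewrite -map_cons; apply/perm_map/uniq_perm; rewrite /= ?enum_uniq ?mem_enum ?andbT //.
    by apply: contra hz => zI; apply/memv_span/map_f; rewrite mem_enum.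
  by move=> x; rewrite mem_enum !inE mem_enum.
have dI : \dim (vspan (vec_from p) A') = #|I|.
  have -> : vspan (vec_from p) A' = <<[seq vec_from p x | x <- enum I]>>%VS.
    apply/eqP; rewrite eqEsubv; apply/andP; split.
      by apply/subv_sumP => z zA'; rewrite -memvE; apply: spI.
    apply/span_subvP => y /mapP[x]; rewrite mem_enum => /(subsetP IA') xA' ->.
    by apply: (subvP (sumv_sup x xA' (subvv _))); apply: memv_line.
  by move: fI => /eqP ->; rewrite size_map -cardE.
rewrite dI in cA'.
have [|S [IS SA' cS]] := @card_subset_between _ I A' (3 * #|I|).+1 IA'.
  by rewrite cA' andbT; lia.
exists p, S, I; split; split=> //.
- exact: (subsetP BA).
- by apply: subset_trans SA' (subset_trans A'B BA).
- by apply: contra pA'; apply: (subsetP SA').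
- exact: indep_sub iA'.
- rewrite lt0n; apply/negP => /eqP I0.
  have [z zA'] : exists z, z \in A' by apply/card_gt0P; apply: leq_ltn_trans cA'.
  have := spI z zA'; rewrite (cards0_eq I0) enum_set0 span_nil memv0 => /eqP/vec_from_eq0 e.
  by rewrite -e zA' in pA'.
- by move=> z /(subsetP SA')/spI.
Qed.

End Points.

(** * Random varieties *)

Section Theta.
Variables (F : finFieldType) (m a r D : nat).
Local Notation q := #|F|.
Local Notation pt := (pt F m).
Local Notation pol := (pol F m).
Implicit Types (A B S : {set pt}) (z p : pt).

Definition theta := (a.-tuple (pol 3) * r.-tuple (pol D))%type.

Definition zeros (t : theta) : {set pt} :=
  [set z | all (fun c => ev c z == 0) t.1 && all (fun c => ev c z == 0) t.2].

Lemma card_theta_vanish A B : indep 3 A -> indep D B ->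
  (#|[set t : theta | all (@vanish _ _ _ A) t.1 && all (@vanish _ _ _ B) t.2]| *
   q ^ (a * #|A| + r * #|B|) = #|{: theta}|)%N.
Proof.
move=> iA iB.
have -> : [set t : theta | all (@vanish _ _ _ A) t.1 && all (@vanish _ _ _ B) t.2] =
  setX [set t : a.-tuple (pol 3) | all (@vanish _ _ _ A) t]
       [set t : r.-tuple (pol D) | all (@vanish _ _ _ B) t].
  by apply/setP => -[t1 t2]; rewrite !inE.
rewrite cardsX !card_all_tuple card_prod !card_tuple.
rewrite -(card_vanish iA) -(card_vanish iB) !expnMn -!expnM.
by rewrite expnD mulnACA ![(_ * #|_|)%N]mulnC.
Qed.

Lemma sub_zeros A t : (A \subset zeros t) =
  all (@vanish _ _ _ A) t.1 && all (@vanish _ _ _ A) t.2.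
Proof.
apply/subsetP/andP => [h|[/allP h1 /allP h2] z zA].
  by split; apply/allP => c hc; apply/forall_inP => z /h; rewrite inE => /andP[/allP h1 /allP h2];
    [apply: h1|apply: h2].
by rewrite inE; apply/andP; split; apply/allP => c hc;
  [have /forall_inP := h1 c hc|have /forall_inP := h2 c hc]; apply.
Qed.

Lemma card_sub_zeros A : indep 3 A -> indep D A ->
  (#|[set t : theta | A \subset zeros t]| * q ^ ((a + r) * #|A|) = #|{: theta}|)%N.
Proof.
move=> i3 iD; rewrite -(card_theta_vanish i3 iD) mulnDl; congr (_ * _)%N.
by apply: eq_card => t; rewrite !inE sub_zeros.
Qed.

Definition general s (X : {set pt}) : bool :=
  [forall A : {set pt}, (A \subset X) && (#|A| <= s)%N ==> indep 3 A].

Section Config.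
Variable d : nat.

(* An origin, d further points and the coordinates of 2d + 1 more points in
   the flat that they span. *)
Definition config := (pt * d.-tuple pt * {ffun 'I_(2 * d).+1 * 'I_d -> F})%type.

Definition config_comb (k : config) (j : 'I_(2 * d).+1) : pt :=
  [ffun l => k.1.1 l + \sum_i k.2 (j, i) * (tnth k.1.2 i l - k.1.1 l)].

Definition config_set (k : config) : {set pt} :=
  [set tnth k.1.2 i | i in 'I_d] :|: [set config_comb k j | j in 'I_(2 * d).+1].

Definition config_ok (k : config) : bool :=
  [&& k.1.1 \notin config_set k, indep 3 (config_set k)
    & #|config_set k| == (3 * d).+1].

Lemma card_config : #|{: config}| = (q ^ (m + m * d + (2 * d).+1 * d))%N.
Proof.
rewrite /config !card_prod card_tuple card_pt card_ffun card_prod !card_ord.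
by rewrite -expnM -!expnD.
Qed.

Lemma card_config_theta s (k : config) : config_ok k -> (3 * d + 2 <= s)%N ->
  (s <= D.+1)%N ->
  (#|[set t : theta | k.1.1 |: config_set k \subset zeros t]| *
   q ^ (a * (3 * d).+1 + r * (3 * d).+2) <= #|{: theta}|)%N.
Proof.
move=> /and3P[kp ki /eqP kc] hs sD.
have c2 : #|k.1.1 |: config_set k| = (3 * d).+2 by rewrite cardsU1 kp kc.
have iD : indep D (k.1.1 |: config_set k) by apply: indep_small; rewrite c2; lia.
rewrite -(card_theta_vanish ki iD) kc c2 leq_mul2r; apply/orP; right.
apply: subset_leq_card; apply/subsetP => t; rewrite !inE sub_zeros => /andP[h1 ->].
rewrite andbT; apply: sub_all h1 => c /forall_inP h; apply/forall_inP => z zS.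
by apply: h; rewrite in_setU zS orbT.
Qed.

End Config.

Lemma nongeneral_config s X : ~~ general s X ->
  exists d (k : config d), [/\ (0 < d)%N, (3 * d + 2 <= s)%N, config_ok k
    & k.1.1 |: config_set k \subset X].
Proof.
move=> /forallPn[A]; rewrite negb_imply => /andP[/andP[AX As] nA].
have [p [S [I [[pA SA pS iS IS] [I0 cS hS]]]]] := dependent_config nA.
pose d := #|I|; pose Xt : d.-tuple 'rV[F]_m := map_tuple (vec_from p) (enum_tuple I).
pose u (j : 'I_(2 * d).+1) : pt := nth p (enum (S :\: I)) j.
have cSI : #|S :\: I| = (2 * d).+1 by rewrite cardsD (setIidPr IS) cS -/d; lia.
have uS j : u j \in S :\: I by rewrite -mem_enum; apply: mem_nth; rewrite -cardE cSI.
pose k : config d := (p, enum_tuple I, [ffun ji => coord Xt ji.2 (vec_from p (u ji.1))]).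
have ku j : config_comb k j = u j.
  apply/ffunP => l; rewrite ffunE /=.
  have hu : vec_from p (u j) \in <<Xt>>%VS by apply: hS; have := uS j; rewrite inE => /andP[].
  have := congr1 (fun t : 'rV[F]_m => t 0 l) (coord_span hu); rewrite mxE summxE => e.
  rewrite -[RHS](subrK (p l)) [RHS]addrC e; congr (_ + _); apply: eq_bigr => i _.
  by rewrite ffunE mxE (nth_map p) ?mxE -?tnth_nth // -cardE.
have kS : config_set k = S.
  apply/setP => z; rewrite inE; apply/orP/idP => [[/imsetP[i _ ->]|/imsetP[j _ ->]]|zS].
  - by apply: (subsetP IS); rewrite -mem_enum; apply: mem_tnth.
  - by rewrite ku; have := uS j; rewrite inE => /andP[].
  have [zI|zI] := boolP (z \in I).
    left; have zt : z \in enum_tuple I by rewrite /= mem_enum.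
    by have /tnthP[i ->] := zt; apply: imset_f.
  have zD : z \in enum (S :\: I) by rewrite mem_enum inE zI zS.
  have hi : (index z (enum (S :\: I)) < (2 * d).+1)%N by rewrite -cSI cardE index_mem.
  right; apply/imsetP; exists (Ordinal hi) => //.
  by rewrite ku /u nth_index.
exists d, k; split=> //.
- have : (#|p |: S| <= #|A|)%N by apply: subset_leq_card; rewrite subUset sub1set pA SA.
  by rewrite cardsU1 pS cS -/d; lia.
- by rewrite /config_ok kS pS iS cS eqxx.
- by rewrite kS; apply: subset_trans AX; rewrite subUset sub1set pA SA.
Qed.

Lemma card_nongeneral s : (2 <= r)%N -> (s <= a)%N -> (m = s + a + r)%N -> (s <= D.+1)%N ->
  (#|[set t : theta | ~~ general s (zeros t)]| * q <= s * #|{: theta}|)%N.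
Proof.
move=> r2 sa hm sD.
pose bad d := [set t : theta | [exists k : config d,
  config_ok k && (k.1.1 |: config_set k \subset zeros t)]].
have bd d : (0 < d)%N -> (3 * d + 2 <= s)%N -> (#|bad d| * q <= #|{: theta}|)%N.
  move=> d0 ds; pose e := (a * (3 * d).+1 + r * (3 * d).+2)%N.
  have le1 : (#|bad d| * q ^ e <= #|{: config d}| * #|{: theta}|)%N.
    apply: (@leq_trans (\sum_(k : config d | config_ok k)
       #|[set t : theta | k.1.1 |: config_set k \subset zeros t]| * q ^ e)).
      rewrite -big_distrl /= leq_mul2r; apply/orP; right.
      apply: (@leq_trans #|\bigcup_(k : config d | config_ok k)
          [set t : theta | k.1.1 |: config_set k \subset zeros t]|).
        apply: subset_leq_card; apply/subsetP => t; rewrite inE => /existsP[k /andP[k1 k2]].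
        by apply/bigcupP; exists k; rewrite ?inE.
      elim/big_ind2: _ => [|A1 n1 A2 n2 h1 h2|//]; first by rewrite cards0.
      by apply: leq_trans (leq_card_setU _ _) _; apply: leq_add.
    rewrite -sum_nat_const [leqRHS](bigID (@config_ok d)) /=; apply: leq_trans (leq_addr _ _).
    by apply: leq_sum => k hk; apply: card_config_theta hk ds sD.
  have q0 : (0 < q)%N by rewrite ltnW // card_finRing_gt1.
  rewrite card_config in le1; set c := (_ + _ + _)%N in le1.
  have ce : (c.+1 <= e)%N.
    rewrite /c /e hm.
    have : (d * (s + a + r) + (d * (2 * d + 1)) + s + 1 <= a * (3 * d) + r * (3 * d) + r)%N by nia.
    nia.
  rewrite -(leq_pmul2l (_ : (0 < q ^ c)%N)) ?expn_gt0 ?q0 //.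
  apply: leq_trans le1; rewrite mulnCA leq_mul2l -expnSr; apply/orP; right.
  by rewrite leq_exp2l // card_finRing_gt1.
pose bad' (d : 'I_s) := if (0 < d)%N && (3 * d + 2 <= s)%N then bad d else set0.
apply: (@leq_trans (\sum_(d < s) #|bad' d| * q)).
  rewrite -big_distrl /= leq_mul2r; apply/orP; right.
  apply: (@leq_trans #|\bigcup_(d < s) bad' d|).
    apply: subset_leq_card; apply/subsetP => t; rewrite inE.
    move=> /nongeneral_config[d [k [d0 ds k1 k2]]].
    have dls : (d < s)%N by lia.
    apply/bigcupP; exists (Ordinal dls) => //.
    rewrite /bad' d0 ds inE; apply/existsP; exists k; by rewrite k1.
  elim/big_ind2: _ => [|A1 n1 A2 n2 h1 h2|//]; first by rewrite cards0.
  by apply: leq_trans (leq_card_setU _ _) _; apply: leq_add.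
rewrite -[X in (_ <= X * _)%N]card_ord -sum_nat_const; apply: leq_sum => d _.
rewrite /bad'; case: ifP => [/andP[d0 ds]|_]; last by rewrite cards0.
exact: bd.
Qed.

End Theta.

Lemma card_sum_pred (T : finType) (P : pred T) : #|[set x | P x]| = (\sum_x P x)%N.
Proof.
rewrite -sum1_card big_mkcond; apply: eq_bigr => x _; rewrite inE.
by case: (P x).
Qed.

Lemma card_prod_sum (T T' : finType) (P : pred (T * T')) :
  #|[set x | P x]| = (\sum_x #|[set y | P (x, y)]|)%N.
Proof.
rewrite card_sum_pred; under [RHS]eq_bigr do rewrite card_sum_pred.
by rewrite pair_big; apply: eq_bigr => -[].
Qed.

Lemma chebyshev (Om E : finType) (P : Om -> E -> bool) (D : {set E}) Q (Z : Om -> nat) :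
  (forall w, Z w = #|[set e in D | P w e]|) ->
  (forall e, e \in D -> #|[set w | P w e]| * Q = #|Om|)%N ->
  (forall e e', e \in D -> e' \in D -> e != e' ->
     #|[set w | P w e && P w e']| * Q ^ 2 = #|Om|)%N ->
  (#|[set w | ~~ ((#|D| <= 2 * (Q * Z w)) && (2 * (Q * Z w) <= 3 * #|D|))]| * #|D|
   <= 4 * Q * #|Om|)%N.
Proof.
move=> hZ h1 h2; set N := #|D|; set bad := [set w | _].
have [N0|Npos] := posnP N; first by rewrite N0 muln0.
have ZE w : Z w = (\sum_(e in D) P w e)%N.
  rewrite hZ card_sum_pred [RHS]big_mkcond; apply: eq_bigr => e _.
  by case: (e \in D).
have S1 : (\sum_w Q * Z w = N * #|Om|)%N.
  rewrite -big_distrr /=; under eq_bigr do rewrite ZE.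
  rewrite exchange_big big_distrr /= -sum_nat_const; apply: eq_bigr => e eD.
  by rewrite -(h1 e eD) mulnC card_sum_pred.
have S2 : (\sum_w (Q * Z w) ^ 2 <= N * (N + Q) * #|Om|)%N.
  under eq_bigr do rewrite expnMn.
  rewrite -big_distrr /=.
  have -> : (\sum_w Z w ^ 2 = \sum_(e in D) \sum_(e' in D) #|[set w | P w e && P w e']|)%N.
    under [LHS]eq_bigr do rewrite ZE -mulnn big_distrlr /=.
    rewrite exchange_big; apply: eq_bigr => e _.
    rewrite exchange_big; apply: eq_bigr => e' _.
    by rewrite card_sum_pred; apply: eq_bigr => w _; rewrite mulnb.
  rewrite big_distrr /= -mulnA -sum_nat_const; apply: leq_sum => e eD.
  rewrite big_distrr /= (bigD1 e) //= addnC mulnDl; apply: leq_add; last first.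
    rewrite -mulnn -mulnA leq_mul2l; apply/orP; right.
    rewrite mulnC -(h1 e eD) leq_mul2r; apply/orP; right.
    by apply: subset_leq_card; apply/subsetP => w; rewrite !inE => /andP[].
  apply: (@leq_trans (\sum_(e' in D | e' != e) #|Om|)).
    by apply: leq_sum => e' /andP[e'D ne]; rewrite mulnC h2 // eq_sym.
  rewrite sum_nat_const leq_mul2r; apply/orP; right.
  by apply: subset_leq_card; apply/subsetP => e' /andP[].
have pw : (\sum_w (8 * N * (Q * Z w) + (w \in bad) * (N * N)) <=
           \sum_w (4 * (Q * Z w) ^ 2 + 4 * (N * N)))%N.
  apply: leq_sum => w _; rewrite inE -mulnn; move: (Q * Z w)%N => x.
  have e1 : (4 * (x * x) = (2 * x) * (2 * x))%N by rewrite mulnACA.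
  have e2 : (8 * N * x = 4 * (N * (2 * x)))%N by lia.
  rewrite e1 e2; move: (2 * x)%N => y {e1 e2 x}.
  have sq : (4 * (N * y) <= y * y + 4 * (N * N))%N.
    have := (nat_Cauchy (2 * N) y).1; rewrite -!mulnn; lia.
  case: (leqP N y) => a1; last first.
    rewrite /= mul1n; have -> : N = (y + (N - y))%N by lia.
    by move: (N - y)%N => k; nia.
  case: (leqP y (3 * N)%N) => a2 /=; first by rewrite mul0n addn0.
  rewrite mul1n; have -> : y = (3 * N + (y - 3 * N))%N by lia.
  by move: (y - 3 * N)%N => k; nia.
have Sb : (\sum_w (w \in bad) = #|bad|)%N.
  by rewrite card_sum_pred; apply: eq_bigr => w _; rewrite inE.
have eL : (\sum_w (8 * N * (Q * Z w) + (w \in bad) * (N * N)) =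
    8 * N * (N * #|Om|) + #|bad| * (N * N))%N.
  by rewrite big_split -big_distrl /= Sb -S1 big_distrr.
have eR : (\sum_w (4 * (Q * Z w) ^ 2 + 4 * (N * N)) =
    4 * (\sum_w (Q * Z w) ^ 2) + #|Om| * (4 * (N * N)))%N.
  by rewrite big_split /= sum_nat_const big_distrr.
move: pw; rewrite eL eR => pw; rewrite -(leq_pmul2l Npos).
move: S2 pw; move: (\sum_w _)%N #|Om| #|bad| => X O B; clearbody N.
by nia.
Qed.

Section Sections.
Variables (F : finFieldType) (m : nat).
Local Notation q := #|F|.
Local Notation pt := (pt F m).
Local Notation pol := (pol F m).
Local Notation mono := 'X_{1..m < 4}.
Implicit Types (x y z : pt).

Definition fam := {ffun mono * mono -> F}.

Definition mon (u : mono) (z : pt) : F := ('X_[val u]).@[z].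

Definition fval (f : fam) x y : F := \sum_u \sum_v f (u, v) * (mon u x * mon v y).

Definition fsec (f : fam) x : pol 3 := [ffun v => \sum_u f (u, v) * mon u x].

Definition ftr (f : fam) : fam := [ffun uv => f (uv.2, uv.1)].

Lemma ev_fsec f x y : ev (fsec f x) y = fval f x y.
Proof.
rewrite evE /fval exchange_big; apply: eq_bigr => v _.
by rewrite ffunE mulr_suml; apply: eq_bigr => u _; rewrite mulrA.
Qed.

Lemma ftrK : involutive ftr.
Proof. by move=> f; apply/ffunP => -[u v]; rewrite !ffunE. Qed.

Lemma fval_tr f x y : fval (ftr f) x y = fval f y x.
Proof.
rewrite /fval exchange_big; apply: eq_bigr => u _; apply: eq_bigr => v _.
by rewrite ffunE [mon _ x * _]mulrC.
Qed.

Lemma fvalD f g x y : fval (f + g) x y = fval f x y + fval g x y.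
Proof.
rewrite /fval -big_split; apply: eq_bigr => u _; rewrite -big_split.
by apply: eq_bigr => v _; rewrite ffunE mulrDl.
Qed.

Definition tensor (c c' : pol 3) : fam := [ffun uv => c uv.1 * c' uv.2].

Lemma fval_tensor c c' x y : fval (tensor c c') x y = ev c x * ev c' y.
Proof.
rewrite !evE /fval mulr_suml; apply: eq_bigr => u _; rewrite mulr_sumr.
by apply: eq_bigr => v _; rewrite ffunE mulrACA.
Qed.

Lemma fam_interp (e e' : pt * pt) (a a' : F) : (e = e' -> a = a') ->
  exists g : fam, fval g e.1 e.2 = a /\ fval g e'.1 e'.2 = a'.
Proof.
move: e e' => [x y] [x' y'] /= eqa.
have small (z z' : pt) : indep 3 [set z; z'] by apply: indep_small; rewrite cards2; case: (_ == _).
have [cx hx] := indep_interp (fun z => if x == x' then 1 else if z == x then a else a') (small x x').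
have [cy hy] := indep_interp (fun z => if x == x' then (if z == y then a else a') else 1) (small y y').
exists (tensor cx cy); rewrite !fval_tensor !hx ?hy ?inE ?eqxx ?orbT //.
have [exx|nx] := eqVneq x x'.
  rewrite ?mul1r ?eqxx; split=> //; case: eqP => // ey; apply: eqa.
  by rewrite exx ey.
by rewrite ?mulr1.
Qed.

Lemma card_fam1 x y : (#|[set f : fam | fval f x y == 0%R]| * q = #|{: fam}|)%N.
Proof.
have := @card_fiber_preim fam F (fun f => fval f x y) [set 0].
rewrite cards1 mul1n => <-; first by congr (_ * _)%N; apply: eq_card => f; rewrite !inE.
move=> w w'; have [g [hg _]] := @fam_interp (x, y) (x, y) (w' - w) (w' - w) (fun _ => erefl).
exists (fun f => f + g); split=> [|f hf]; first exact: addIr.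
by rewrite fvalD hf hg addrCA subrr addr0.
Qed.

Lemma card_fam2 (e e' : pt * pt) : e != e' ->
  (#|[set f : fam | (fval f e.1 e.2 == 0%R) && (fval f e'.1 e'.2 == 0%R)]| * q ^ 2 = #|{: fam}|)%N.
Proof.
move=> ne.
have := @card_fiber_preim fam (F * F)%type (fun f => (fval f e.1 e.2, fval f e'.1 e'.2)) [set (0, 0)].
rewrite cards1 mul1n card_prod mulnn => <-.
  by congr (_ * _)%N; apply: eq_card => f; rewrite !inE xpair_eqE.
move=> [w1 w2] [w1' w2'].
have [|g [h1 h2]] := @fam_interp e e' (w1' - w1) (w2' - w2).
  by move=> eq; rewrite eq eqxx in ne.
exists (fun f => f + g); split=> [|f [hf1 hf2]]; first exact: addIr.
by rewrite !fvalD hf1 hf2 h1 h2 /= ![_ + (_ - _)]addrC !subrK.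
Qed.

Lemma card_fsec s (xs : s.-tuple pt) (B : {set s.-tuple (pol 3)}) :
  uniq xs -> indep 3 [set x in xs] ->
  (#|[set f : fam | [tuple fsec f (tnth xs i) | i < s] \in B]| * #|{: pol 3}| ^ s =
   #|B| * #|{: fam}|)%N.
Proof.
move=> us ixs.
have := @card_fiber_preim fam (s.-tuple (pol 3)) (fun f => [tuple fsec f (tnth xs i) | i < s]) B.
rewrite card_tuple; apply=> w w'.
have ex (i : 'I_s) : exists c : pol 3, forall j, ev c (tnth xs j) = (i == j)%:R.
  have [c hc] := indep_interp (fun z => (z == tnth xs i)%:R) ixs.
  exists c => j; rewrite hc ?inE ?mem_tnth // eq_sym.
  by rewrite (inj_eq (elimT (tuple_uniqP xs) us)).
have [c hc] := choice ex.
pose g : fam := [ffun uv => \sum_i c i uv.1 * (tnth w' i uv.2 - tnth w i uv.2)].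
exists (fun f => f + g); split=> [|f hf]; first exact: addIr.
apply: eq_from_tnth => j; rewrite tnth_mktuple; apply/ffunP => v.
have hj : tnth w j = fsec f (tnth xs j) by rewrite -hf tnth_mktuple.
rewrite ffunE (eq_bigr (fun u => f (u, v) * mon u (tnth xs j) +
   \sum_i (c i u * mon u (tnth xs j)) * (tnth w' i v - tnth w i v))); last first.
  move=> u _; rewrite !ffunE mulrDl; congr (_ + _) => /=.
  by rewrite mulr_suml; apply: eq_bigr => i _; rewrite mulrAC.
rewrite big_split /= exchange_big /= (bigD1 j) //= -mulr_suml -evE hc eqxx mul1r.
rewrite [X in _ + (_ + X)]big1 => [|i ne]; last first.
  by rewrite -mulr_suml -evE hc (negPf ne) mul0r.
have -> : \sum_u f (u, v) * mon u (tnth xs j) = tnth w j v by rewrite hj ffunE.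
by rewrite addr0 addrCA subrr addr0.
Qed.

End Sections.

Lemma mem_extend (F : finFieldType) m d gs (t : seq (pol F m d)) g :
  g \in extend gs t -> g \in gs \/ exists2 c, c \in t & g = topoly c.
Proof.
rewrite /extend catrevE mem_cat mem_rev => /orP[/mapP[c ct ->]|]; last by left.
by right; exists c.
Qed.

Lemma size_extend (F : finFieldType) m d gs (t : seq (pol F m d)) :
  size (extend gs t) = (size t + size gs)%N.
Proof. by rewrite /extend catrevE size_cat size_rev size_map. Qed.

Lemma bounded_extend (F : finFieldType) m d gs ds (t : seq (pol F m d)) :
  (0 < d)%N -> bounded_by gs ds -> bounded_by (extend gs t) (nseq (size t) d ++ ds).
Proof.
move=> d0; rewrite /extend; elim: t gs ds => //= c t IH gs ds h.
have := IH (topoly c :: gs) (d :: ds) (bounded_cons c d0 h).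
by congr bounded_by; elim: (size t) => //= n ->.
Qed.

Section Tuples.
Variables (s r D : nat).
Hypotheses (D0 : (0 < D)%N).
Local Notation m := (s + s + r)%N.
Local Notation pts F := (pt F m).

Definition neighbour_system (F : finFieldType) (t : theta F m s r D) (xs : s.-tuple (pts F)) (f : fam F m) :=
  extend (extend (extend [::] t.1) [tuple fsec f (tnth xs i) | i < s]) t.2.

Lemma neighbour_system_bounded (F : finFieldType) (t : theta F m s r D) xs f :
  bounded_by (neighbour_system t xs f) (nseq r D ++ nseq s 3 ++ nseq s 3).
Proof.
have b1 : bounded_by (extend [::] t.1) (nseq s 3).
  by have := @bounded_extend F m 3 [::] [::] t.1 isT isT; rewrite cats0 size_tuple.
have := @bounded_extend F m 3 _ _ [tuple fsec f (tnth xs i) | i < s] isT b1.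
rewrite size_tuple => /(@bounded_extend F m D _ _ t.2 D0).
by rewrite size_tuple.
Qed.

Lemma card_common_neighbours (F : finFieldType) (t : theta F m s r D) xs f :
  flat_regular 0 (neighbour_system t xs f) ->
  (#|[set y in zeros t | [forall i, fval f (tnth xs i) y == 0%R]]| <= 9 ^ s * D ^ r)%N.
Proof.
move=> [reg _]; set Z := [set y in zeros t | _].
have := @bezout F m (neighbour_system t xs f) _ Z (neighbour_system_bounded t xs f) reg.
rewrite !big_cat /= !big_nseq !iter_muln_1 mulnC -expnMn; apply.
  by rewrite !size_extend !size_tuple /=; lia.
move=> y g; rewrite !inE => /andP[/andP[/allP h1 /allP h2] /forallP h3].
move=> /mem_extend[/mem_extend[/mem_extend[//|]|]|] [c ct ->].
- by apply/eqP/h1.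
- by have /tnthP[i ->] := ct; rewrite tnth_mktuple; apply/eqP; rewrite -/(ev _ _) ev_fsec.
- by apply/eqP/h2.
Qed.

Lemma card_degenerate_tuple :
  (s ^ 2 + 1 <= tau r.+1 3)%N -> (s ^ 2 <= D)%N ->
  exists q0 C, forall (F : finFieldType) (t1 : s.-tuple (pol F m 3)) (xs : s.-tuple (pts F)),
    (q0 <= #|F|)%N -> flat_regular (s + r) (extend [::] t1) -> uniq xs -> indep 3 [set x in xs] ->
    (#|[set p : r.-tuple (pol F m D) * fam F m | ~~ `[< flat_regular 0 (neighbour_system (t1, p.1) xs p.2) >]]|
       * #|F| ^ (s ^ 2 + 1) <= C * (#|{: r.-tuple (pol F m D)}| * #|{: fam F m}|))%N.
Proof.
move=> hr hD.
have [q1 [C1 h1]] := @card_not_flat_regular m 3 s (3 ^ s) isT.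
have [q2 [C2 h2]] := @card_not_flat_regular m D r (3 ^ s * 3 ^ s) D0.
exists (maxn q1 q2), (C1 + C2)%N => F t1 xs; rewrite geq_max => /andP[hq1 hq2] gt1 us ixs.
set T2 := r.-tuple (pol F m D); set Fm := fam F m; set Q := (#|F| ^ _)%N.
have F1 : (1 < #|F|)%N by apply: card_finRing_gt1.
have b1 : bounded_by (extend [::] t1) (nseq s 3).
  by have := @bounded_extend F m 3 [::] [::] t1 isT isT; rewrite cats0 size_tuple.
have p1 : (\prod_(e <- nseq s 3) e = 3 ^ s)%N by rewrite big_nseq iter_muln_1.
set B1 := [set t : s.-tuple (pol F m 3) | ~~ `[< flat_regular r (extend (extend [::] t1) t) >]].
have hB1 : (#|B1| * Q <= C1 * #|{: pol F m 3}| ^ s)%N.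
  have := h1 F (extend [::] t1) (nseq s 3) r hq1 b1 p1.
  rewrite size_extend size_tuple addn0 [(r + s)%N]addnC => /(_ _ gt1) h.
  apply: leq_trans (h _); last by lia.
  by rewrite leq_mul2l leq_exp2l // hr orbT.
pose sec f := [tuple fsec f (tnth xs i) | i < s].
pose B2 (f : Fm) := [set t : T2 | ~~ `[< flat_regular 0 (extend (extend (extend [::] t1) (sec f)) t) >]].
have hB2 f : sec f \notin B1 -> (#|B2 f| * Q <= C2 * #|{: T2}|)%N.
  rewrite inE negbK => /asboolP gf.
  have b2 : bounded_by (extend (extend [::] t1) (sec f)) (nseq s 3 ++ nseq s 3).
    by have := @bounded_extend F m 3 _ _ (sec f) isT b1; rewrite size_tuple.
  have p2 : (\prod_(e <- nseq s 3 ++ nseq s 3) e = 3 ^ s * 3 ^ s)%N by rewrite big_cat /= p1.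
  have := h2 F _ _ 0%N hq2 b2 p2.
  rewrite !size_extend !size_tuple addn0 add0n card_tuple => h.
  apply: leq_trans (h _ gf); last by lia.
  rewrite leq_mul2l leq_exp2l //; apply/orP; right.
  rewrite /tau bin1; lia.
have hF : (#|[set f : Fm | sec f \in B1]| * Q <= C1 * #|{: Fm}|)%N.
  have := card_fsec B1 us ixs; rewrite -/sec -/Fm => e.
  have P0 : (0 < #|{: pol F m 3}| ^ s)%N.
    by rewrite expn_gt0 card_pol expn_gt0 (ltnW F1).
  rewrite -(leq_pmul2r P0) mulnAC e mulnAC [leqRHS]mulnAC leq_mul2r; apply/orP; right.
  exact: hB1.
have -> : #|[set p : T2 * Fm | ~~ `[< flat_regular 0 (neighbour_system (t1, p.1) xs p.2) >]]| =
    (\sum_(f : Fm) #|B2 f|)%N.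
  rewrite card_prod_sum; under eq_bigr do rewrite card_sum_pred.
  rewrite exchange_big; apply: eq_bigr => f _; rewrite card_sum_pred.
  by apply: eq_bigr.
rewrite big_distrl /= (bigID (fun f => sec f \in B1)) /= mulnDl; apply: leq_add.
  apply: (@leq_trans (\sum_(f : Fm | sec f \in B1) #|{: T2}| * Q)).
    by apply: leq_sum => f _; rewrite leq_mul2r max_card orbT.
  rewrite sum_nat_const mulnCA [leqRHS]mulnCA leq_mul2l; apply/orP; right.
  by move: hF; congr (_ * _ <= _)%N; apply: eq_card => f; rewrite inE.
apply: (@leq_trans (\sum_(f : Fm | sec f \notin B1) C2 * #|{: T2}|)).
  by apply: leq_sum => f; apply: hB2.
by rewrite sum_nat_const mulnC mulnA leq_mul2l max_card orbT.
Qed.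

Definition typical (F : finFieldType) (t : theta F m s r D) : bool :=
  [&& (#|F| ^ s <= 2 * #|zeros t|)%N, (2 * #|zeros t| <= 3 * #|F| ^ s)%N,
      general s (zeros t) & `[< flat_regular (s + r) (extend [::] t.1) >]].

Lemma card_not_typical : (2 <= r)%N -> (s <= D.+1)%N -> (0 < s)%N ->
  exists q0 C, forall F : finFieldType, (q0 <= #|F|)%N ->
    (#|[set t : theta F m s r D | ~~ typical t]| * #|F| <= C * #|{: theta F m s r D}|)%N.
Proof.
move=> r2 sD s0; have [q1 [C1 h1]] := @card_not_flat_regular m 3 s 1 isT.
exists q1, (4 + s + C1)%N => F hq; set Th := theta F m s r D; set q := #|F|.
have F1 : (1 < q)%N by apply: card_finRing_gt1.
have q0 : (0 < q)%N by apply: ltnW.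
pose A1 := [set t : Th | ~~ ((#|[set: pts F]| <= 2 * (q ^ (s + r) * #|zeros t|)) &&
   (2 * (q ^ (s + r) * #|zeros t|) <= 3 * #|[set: pts F]|))%N].
pose A2 := [set t : Th | ~~ general s (zeros t)].
pose A3 := [set t : Th | ~~ `[< flat_regular (s + r) (extend [::] t.1) >]].
have sub : [set t : Th | ~~ typical t] \subset A1 :|: A2 :|: A3.
  apply/subsetP => t; rewrite inE; apply: contraR; rewrite !in_setU !negb_or.
  move=> /andP[/andP[n1 n2] n3].
  rewrite inE negbK in n1; rewrite inE negbK in n2; rewrite inE negbK in n3.
  have P0 : (0 < q ^ (s + r))%N by rewrite expn_gt0 q0.
  have e : (#|[set: pts F]| = q ^ (s + r) * q ^ s)%N.
    by rewrite cardsT card_pt -expnD; congr (_ ^ _)%N; lia.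
  move: n1; rewrite e mulnCA leq_pmul2l // [(3 * _)%N]mulnCA leq_pmul2l // => /andP[h2 h3].
  by apply/and4P; split.
apply: (@leq_trans ((#|A1| + #|A2| + #|A3|) * q)).
  rewrite leq_mul2r; apply/orP; right; apply: leq_trans (subset_leq_card sub) _.
  apply: leq_trans (leq_card_setU _ _) _; rewrite leq_add2r.
  exact: leq_card_setU.
rewrite !mulnDl; apply: leq_add; [apply: leq_add|].
- have small (A : {set pts F}) d : (#|A| <= d.+1)%N -> indep d A by apply: indep_small.
  have h := @chebyshev Th (pts F) (fun t z => z \in zeros t) setT (q ^ (s + r)) (fun t => #|zeros t|).
  have {}h : (#|A1| * #|[set: pts F]| <= 4 * q ^ (s + r) * #|{: Th}|)%N.
    apply: h => [w|z _|z z' _ _ ne].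
    + by apply: eq_card => z; rewrite !inE.
    + have := @card_sub_zeros F m s r D [set z].
      rewrite cards1 muln1 => <-; try by apply: small; rewrite cards1; lia.
      by congr (_ * _)%N; apply: eq_card => t; rewrite !inE sub1set inE.
    + have := @card_sub_zeros F m s r D [set z; z'].
      rewrite cards2 ne expnM => <-; try by apply: small; rewrite cards2 ne; lia.
      by congr (_ * _)%N; apply: eq_card => t; rewrite !inE subUset !sub1set !inE.
  rewrite cardsT card_pt -/q in h.
  have P0 : (0 < q ^ (s + r))%N by rewrite expn_gt0 q0.
  rewrite -(leq_pmul2r P0); apply: (@leq_trans (#|A1| * q ^ m)).
    rewrite -mulnA leq_mul2l -expnS leq_exp2l //; apply/orP; right; lia.
  by apply: leq_trans h _; rewrite -!mulnA leq_mul2l [(_ * #|_|)%N]mulnC leqnn.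
- by apply: card_nongeneral => //; lia.
have := h1 F [::] [::] (s + r)%N hq isT (big_nil _ _ _ _).
have em : (s + r + s = m)%N by lia.
rewrite /= addn0 em => /(_ erefl (flat_regular_nil _ _)).
set B := [set t : s.-tuple _ | _] => hB.
have -> : A3 = setX B setT by apply/setP => -[t1 t2]; rewrite !inE andbT.
rewrite cardsX cardsT card_prod mulnAC mulnA leq_mul2r; apply/orP; right.
rewrite card_tuple; apply: leq_trans hB; rewrite leq_mul2l -[X in (X <= _)%N]expn1 leq_exp2l //; apply/orP; right.
by rewrite bin_gt0 leq_addl.
Qed.

Definition degenerate_pair (F : finFieldType) (t t' : theta F m s r D) (f : fam F m) : bool :=
  [exists xs : s.-tuple (pts F), [&& uniq xs, all (mem (zeros t)) xs
     & ~~ `[< flat_regular 0 (neighbour_system t' xs f) >]]].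

Lemma card_degenerate_pair : (0 < s)%N ->
  (s ^ 2 + 1 <= tau r.+1 3)%N -> (s ^ 2 <= D)%N ->
  exists q0 C, forall F : finFieldType, (q0 <= #|F|)%N ->
  forall t : theta F m s r D, typical t ->
    (\sum_(t' : theta F m s r D | typical t') #|[set f | degenerate_pair t t' f]| * #|F| <=
     C * (#|{: theta F m s r D}| * #|{: fam F m}|))%N.
Proof.
move=> s0 hr hD; have [q0 [C hC]] := card_degenerate_tuple hr hD.
exists q0, (2 ^ s * C)%N => F hq t /and4P[X1 X2 gX _].
set Th := theta F m s r D; set q := #|F|; set Fm := fam F m.
set T1 := s.-tuple (pol F m 3); set T2 := r.-tuple (pol F m D).
have F1 : (1 < q)%N by apply: card_finRing_gt1.
have X3 : (#|zeros t| <= 2 * q ^ s)%N by move: X2; rewrite -/q; lia.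
pose P (t1 : T1) := [set p : T2 * Fm | degenerate_pair t (t1, p.1) p.2].
have hP (t1 : T1) : flat_regular (s + r) (extend [::] t1) -> (#|P t1| * q <= 2 ^ s * C * (#|{: T2}| * #|{: Fm}|))%N.
  move=> gt1.
  pose N (xs : s.-tuple (pts F)) := [set p : T2 * Fm | ~~ `[< flat_regular 0 (neighbour_system (t1, p.1) xs p.2) >]].
  pose I := [set xs : s.-tuple (pts F) | uniq xs && all (mem (zeros t)) xs].
  have cI : (#|I| <= (2 * q ^ s) ^ s)%N.
    apply: (@leq_trans (#|zeros t| ^ s)); last by rewrite leq_exp2r.
    have := card_all_tuple s (mem (zeros t)); rewrite (_ : [set x | mem (zeros t) x] = zeros t).
      move=> <-; apply: subset_leq_card; apply/subsetP => xs; rewrite !inE.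
      by case/andP.
    by apply/setP => x; rewrite inE.
  have h1 : (#|P t1| <= \sum_(xs in I) #|N xs|)%N.
    apply: (@leq_trans #|\bigcup_(xs in I) N xs|).
      apply: subset_leq_card; apply/subsetP => p; rewrite inE => /existsP[xs /and3P[us ax nx]].
      by apply/bigcupP; exists xs; rewrite !inE ?us.
    elim/big_ind2: _ => [|B1 n1 B2 n2 k1 k2|//]; first by rewrite cards0.
    by apply: leq_trans (leq_card_setU _ _) _; apply: leq_add.
  have Q0 : (0 < q ^ (s ^ 2))%N by rewrite expn_gt0 (ltnW F1).
  rewrite -(leq_pmul2r Q0) -mulnA -expnS -[(s ^ 2).+1]addn1.
  apply: (@leq_trans (\sum_(xs in I) #|N xs| * q ^ (s ^ 2 + 1))).
    by rewrite -big_distrl /= leq_mul2r h1 orbT.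
  apply: (@leq_trans (\sum_(xs in I) C * (#|{: T2}| * #|{: Fm}|))).
    apply: leq_sum => xs; rewrite inE => /andP[us ax]; apply: hC => //.
    apply: (implyP (forallP gX _)); rewrite cardsE (card_uniqP us) size_tuple leqnn andbT.
    by apply/subsetP => x; rewrite inE => /(allP ax).
  rewrite sum_nat_const; apply: (@leq_trans ((2 * q ^ s) ^ s * (C * (#|{: T2}| * #|{: Fm}|)))).
    by rewrite leq_mul2r cI orbT.
  rewrite expnMn -expnM mulnn; move: (2 ^ s)%N (q ^ (s ^ 2))%N (#|_| * #|_|)%N => a b Y; lia.
apply: (@leq_trans (\sum_(t1 : T1 | `[< flat_regular (s + r) (extend [::] t1) >]) #|P t1| * q)).
  rewrite -!big_distrl /= leq_mul2r; apply/orP; right.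
  under [leqRHS]eq_bigr do rewrite card_prod_sum.
  rewrite pair_big_dep big_mkcond [leqRHS]big_mkcond /=; apply: leq_sum => -[t1 t2] _ /=.
  by case: ifP => // /and4P[_ _ _ /= ->].
apply: (@leq_trans (\sum_(t1 : T1 | `[< flat_regular (s + r) (extend [::] t1) >])
    2 ^ s * C * (#|{: T2}| * #|{: Fm}|))).
  by apply: leq_sum => t1 /asboolP; apply: hP.
rewrite sum_nat_const mulnCA leq_mul2l; apply/orP; right.
by rewrite mulnA leq_mul2r card_prod leq_mul2r max_card !orbT.
Qed.

End Tuples.

Section Union.
Variables (s r D : nat).
Hypotheses (s0 : (0 < s)%N) (r2 : (2 <= r)%N) (hr : (s ^ 2 + 1 <= tau r.+1 3)%N)
  (hD : (s ^ 2 <= D)%N).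
Local Notation m := (s + s + r)%N.

Lemma D_gt0 : (0 < D)%N.
Proof. by apply: leq_trans hD; rewrite expn_gt0 s0. Qed.

Definition edge_set (F : finFieldType) (t t' : theta F m s r D) (f : fam F m) :=
  [set e in setX (zeros t) (zeros t') | fval f e.1 e.2 == 0].

Definition few_edges (F : finFieldType) (t t' : theta F m s r D) (f : fam F m) : bool :=
  ~~ (#|zeros t| * #|zeros t'| <= 2 * (#|F| * #|edge_set t t' f|))%N.

Lemma card_few_edges (F : finFieldType) (t t' : theta F m s r D) : typical t -> typical t' ->
  (#|[set f | few_edges t t' f]| * #|F| <= 16 * #|{: fam F m}|)%N.
Proof.
move=> /and4P[X1 _ _ _] /and4P[Y1 _ _ _]; set q := #|F| in X1 Y1 *.
have q0 : (0 < q)%N by apply: ltnW; apply: card_finRing_gt1.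
have := @chebyshev (fam F m) _ (fun f e => fval f e.1 e.2 == 0)
  (setX (zeros t) (zeros t')) q (fun f => #|edge_set t t' f|) (fun _ => erefl).
rewrite cardsX => h.
have {}h : (#|[set f | few_edges t t' f]| * (#|zeros t| * #|zeros t'|) <= 4 * q * #|{: fam F m}|)%N.
  apply: leq_trans (h _ _).
  - rewrite leq_mul2r; apply/orP; right; apply: subset_leq_card; apply/subsetP => f.
    by rewrite !inE negb_and /few_edges => ->.
  - by move=> [x y] _; apply: card_fam1.
  - by move=> e e' _ _; apply: card_fam2.
rewrite -(leq_pmul2r q0).
apply: (@leq_trans (#|[set f | few_edges t t' f]| * ((2 * #|zeros t|) * (2 * #|zeros t'|)))).
  rewrite -mulnA leq_mul2l; apply/orP; right; apply: leq_mul.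
    by apply: leq_trans X1; rewrite -{1}[q]expn1 leq_pexp2l.
  by apply: leq_trans Y1; rewrite -{1}[q]expn1 leq_pexp2l.
move: h; set a := #|[set f | few_edges t t' f]|; set b := #|{: fam F m}|.
by move: a b #|zeros t| #|zeros t'| => a b x y; lia.
Qed.

Lemma union_bound : exists q0, forall F : finFieldType, (q0 <= #|F|)%N ->
  exists (t t' : theta F m s r D) (f : fam F m),
    [/\ typical t, typical t', ~~ degenerate_pair t t' f, ~~ degenerate_pair t' t (ftr f) & ~~ few_edges t t' f].
Proof.
have sD : (s <= D.+1)%N by apply: leq_trans (leqW hD); rewrite -{1}[s]expn1 leq_pexp2l.
have [q1 [C1 h1]] := @card_not_typical s r D D_gt0 r2 sD s0.
have [q2 [C2 h2]] := @card_degenerate_pair s r D D_gt0 s0 hr hD.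
exists (maxn q1 (maxn q2 (C1 + C1 + C2 + C2 + 16).+1)) => F; rewrite !geq_max => /and3P[hq1 hq2 hq3].
apply: contrapT => no.
have {}h1 := h1 F hq1; have {}h2 := h2 F hq2.
set Th := theta F m s r D in no h1 h2; set Fm := fam F m in no h2; set q := #|F| in hq3 h1 h2.
set n := #|{: Th}| in h1 h2; set p := #|{: Fm}| in h2.
pose n3 (t t' : Th) := #|[set f : Fm | degenerate_pair t t' f]|.
pose n4 (t t' : Th) := #|[set f : Fm | degenerate_pair t' t (ftr f)]|.
pose n5 (t t' : Th) := #|[set f : Fm | few_edges t t' f]|.
have n43 t t' : n4 t t' = n3 t' t.
  rewrite /n4 /n3 -(card_imset _ (inv_inj (@ftrK F m))); apply: eq_card => f.
  rewrite inE; apply/imsetP/idP => [[g + ->]|h]; first by rewrite inE.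
  by exists (ftr f); rewrite ?ftrK // inE ftrK.
have cover (t t' : Th) : (p <= ~~ typical t * p + ~~ typical t' * p +
    (typical t && typical t') * (n3 t t' + n4 t t' + n5 t t'))%N.
  have [nt|] /= := boolP (typical t); last by rewrite mul1n -addnA leq_addr.
  have [nt'|] /= := boolP (typical t'); last by rewrite mul1n mul0n add0n leq_addr.
  rewrite !mul0n mul1n !add0n.
  apply: (@leq_trans #|[set f | degenerate_pair t t' f] :|: [set f | degenerate_pair t' t (ftr f)] :|:
    [set f | few_edges t t' f]|).
    rewrite /p -cardsT; apply: subset_leq_card; apply/subsetP => f _.
    rewrite !inE; apply: contraT; rewrite !negb_or => /andP[/andP[b1 b2] b3].
    by case: no; exists t, t', f.
  apply: leq_trans (leq_card_setU _ _) _; rewrite leq_add2r; exact: leq_card_setU.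
have S1 : (\sum_(t : Th) \sum_(t' : Th) ~~ typical t * p * q <= C1 * (n * n * p))%N.
  under eq_bigr do rewrite sum_nat_const -/n.
  rewrite -big_distrr -!big_distrl /= -card_sum_pred.
  have := leq_mul (leqnn (n * p)) h1.
  by move: #|[set t : Th | ~~ typical t]| => x; lia.
have S2 : (\sum_(t : Th) \sum_(t' : Th) ~~ typical t' * p * q <= C1 * (n * n * p))%N.
  by rewrite exchange_big; apply: S1.
have S3 : (\sum_(t : Th) \sum_(t' : Th) (typical t && typical t') * n3 t t' * q <= C2 * (n * n * p))%N.
  apply: (@leq_trans (\sum_(t : Th) C2 * (n * p))); last first.
    by rewrite sum_nat_const -/n; lia.
  apply: leq_sum => t _; have [nt|_] := boolP (typical t); last first.
    by rewrite big1.
  apply: leq_trans (h2 t nt); rewrite [leqRHS]big_mkcond; apply: leq_sum => t' _.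
  by case: (typical t'); rewrite /= ?mul1n.
have S4 : (\sum_(t : Th) \sum_(t' : Th) (typical t && typical t') * n4 t t' * q <= C2 * (n * n * p))%N.
  rewrite exchange_big; apply: leq_trans S3; apply: leq_sum => t _; apply: leq_sum => t' _.
  by rewrite n43 andbC.
have S5 : (\sum_(t : Th) \sum_(t' : Th) (typical t && typical t') * n5 t t' * q <= 16 * (n * n * p))%N.
  apply: (@leq_trans (\sum_(t : Th) \sum_(t' : Th) 16 * p)); last first.
    by rewrite !sum_nat_const -/n; lia.
  apply: leq_sum => t _; apply: leq_sum => t' _.
  have [/andP[nt nt']|//] := boolP (typical t && typical t').
  by rewrite mul1n; apply: card_few_edges.
have tot : (n * n * p * q <= (C1 + C1 + C2 + C2 + 16) * (n * n * p))%N.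
  rewrite !mulnDl; apply: leq_trans (leq_add (leq_add (leq_add (leq_add S1 S2) S3) S4) S5).
  rewrite -!big_split /=.
  apply: (@leq_trans (\sum_(t : Th) \sum_(t' : Th) p * q)).
    by rewrite !sum_nat_const -/n; lia.
  apply: leq_sum => t _; rewrite -!big_split /=; apply: leq_sum => t' _.
  rewrite -!mulnDl leq_mul2r; apply/orP; right; apply: leq_trans (cover t t') _.
  by apply: eq_leq; move: (typical t) (typical t') => a b; lia.
have F1 : (0 < q)%N by apply: ltnW; apply: card_finRing_gt1.
have pos : (0 < n * n * p)%N.
  rewrite !muln_gt0 /n /p /Th /theta card_prod !card_tuple !card_pol card_ffun muln_gt0.
  by rewrite !expn_gt0 F1.
by move: tot; rewrite mulnC leq_pmul2r // leqNgt hq3.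
Qed.

Lemma neighbours_bound (F : finFieldType) (t t' : theta F m s r D) f (A : {set pt F m}) :
  ~~ degenerate_pair t t' f -> A \subset zeros t -> #|A| = s ->
  (#|[set y in zeros t' | [forall x in A, fval f x y == 0%R]]| <= 9 ^ s * D ^ r)%N.
Proof.
move=> /existsPn nb AX cA.
have sz : size (enum A) == s by rewrite -cardE cA.
have := nb (Tuple sz); rewrite enum_uniq /=.
have -> : all (mem (zeros t)) (enum A) by apply/allP => x; rewrite mem_enum; apply: (subsetP AX).
rewrite negbK => /asboolP /(card_common_neighbours D_gt0); apply: leq_trans.
apply: subset_leq_card; apply/subsetP => y; rewrite !inE => /andP[-> /forall_inP h] /=.
by apply/forallP => i; apply: h; rewrite -mem_enum; apply: (mem_tnth i (Tuple sz)).
Qed.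

End Union.

Lemma bipartite_construction s r D :
  (0 < s)%N -> (2 <= r)%N -> (s ^ 2 + 1 <= 'C(r + 4, 3))%N -> (s ^ 2 <= D)%N ->
  exists q0, forall j, (q0 <= 2 ^ j)%N ->
  exists (V : finType) (X Y : {set V}) (e : rel V), let q := (2 ^ j)%N in
    [/\ (q ^ s <= 2 * #|X| <= 3 * q ^ s)%N, (q ^ s <= 2 * #|Y| <= 3 * q ^ s)%N,
        (#|X| * #|Y| <= 2 * (q * #|[set p in setX X Y | e p.1 p.2]|))%N,
        forall A : {set V}, A \subset X -> #|A| = s ->
          (#|[set y in Y | [forall x in A, e x y]]| <= 9 ^ s * D ^ r)%N
      & forall B : {set V}, B \subset Y -> #|B| = s ->
          (#|[set x in X | [forall y in B, e x y]]| <= 9 ^ s * D ^ r)%N].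
Proof.
move=> s0 r2 hr hD.
have hr' : (s ^ 2 + 1 <= tau r.+1 3)%N.
  by rewrite /tau -(bin_sub (leq_addl 3 r.+1)) addnK (_ : 3 + r.+1 = r + 4)%N //; lia.
have [q0 hq0] := union_bound s0 r2 hr' hD.
exists (maxn q0 2) => j; rewrite geq_max => /andP[hq h2].
have j0 : (0 < j)%N by case: j h2 {hq}.
have [F _ cF] := @pPrimePowerField 2 j isT j0.
have [|t [t' [f [n1 n2 b1 b2 nf]]]] := hq0 F; first by rewrite cF.
exists _, (zeros t), (zeros t'), (fun x y => fval f x y == 0) => /=.
rewrite -cF; split.
- by case/and4P: n1 => -> ->.
- by case/and4P: n2 => -> ->.
- by move: nf; rewrite negbK.
- by move=> A; apply: neighbours_bound b1.
move=> B hB cB; apply: leq_trans (neighbours_bound s0 hD b2 hB cB).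
apply: subset_leq_card; apply/subsetP => x; rewrite !inE => /andP[-> /forall_inP h] /=.
by apply/forall_inP => y /h; rewrite fval_tr.
Qed.

End RandomVarieties.

(** * The extremal number *)

Lemma extremal_ge (n s t T : nat) (V : finType) (X Y : {set V}) (e : rel V) :
  0 < s -> T < t -> #|X| + #|Y| <= n ->
  (forall A : {set V}, A \subset X -> #|A| = s ->
     #|[set y in Y | [forall x in A, e x y]]| <= T) ->
  (forall B : {set V}, B \subset Y -> #|B| = s ->
     #|[set x in X | [forall y in B, e x y]]| <= T) ->
  #|[set p in setX X Y | e p.1 p.2]| <= extremal n (biclique s t).
Proof.
move=> s0 Tt hn hA hB.
pose U := ({x | x \in X} + {y | y \in Y})%type.
have hU : #|{: U}| <= n by rewrite card_sum !card_sig; apply: leq_trans hn; apply: leq_add;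
  apply: eq_leq; apply: eq_card => z; rewrite inE.
pose io (u : U) : 'I_n := widen_ord hU (enum_rank u).
have ioI : injective io by move=> u v /(congr1 val) /= /val_inj /enum_rank_inj.
pose E0 := [set p : {x | x \in X} * {y | y \in Y} | e (val p.1) (val p.2)].
pose ed (p : {x | x \in X} * {y | y \in Y}) : {set 'I_n} := [set io (inl p.1); io (inr p.2)].
pose EE := ed @: E0.
have ok : [forall f in EE, #|f| == 2].
  apply/forall_inP => _ /imsetP[p _ ->]; by rewrite cards2 (inj_eq ioI).
have edP (a b : 'I_n) : [set a; b] \in EE -> exists x y, e (val x) (val y) /\
    ((a = io (inl x) /\ b = io (inr y)) \/ (a = io (inr y) /\ b = io (inl x))).
  move=> /imsetP[[x y]]; rewrite inE /= => exy eq; exists x, y; split=> //.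
  have ha : a \in ed (x, y) by rewrite -eq !inE eqxx.
  have hb : b \in ed (x, y) by rewrite -eq !inE eqxx orbT.
  have hx : io (inl x) \in [set a; b] by rewrite eq !inE eqxx.
  have hy : io (inr y) \in [set a; b] by rewrite eq !inE eqxx orbT.
  move: ha hb hx hy; rewrite !inE /=.
  move=> /orP[] /eqP -> /orP[] /eqP -> /orP[] /eqP h1 /orP[] /eqP h2;
    by [left|right|move/ioI: h1|move/ioI: h2].
have cE : #|EE| = #|[set p in setX X Y | e p.1 p.2]|.
  rewrite card_in_imset => [|[x y] [x' y'] _ _ eq].
    rewrite -(card_imset (f := fun p => (val p.1, val p.2)) E0); last first.
      by move=> [x y] [x' y'] [/val_inj -> /val_inj ->].
    apply: eq_card => -[x y]; rewrite !inE /=; apply/imsetP/andP.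
      move=> [[x' y']]; rewrite inE /= => h [-> ->]; split=> //.
      by rewrite (valP x') (valP y').
    move=> [/andP[xX yY] h]; exists (exist _ x xX, exist _ y yY) => //.
    by rewrite inE.
  have hx : io (inl x) \in ed (x', y') by rewrite -eq !inE eqxx.
  have hy : io (inr y) \in ed (x', y') by rewrite -eq !inE eqxx orbT.
  move: hx hy; rewrite !inE /=.
  by move=> /orP[] /eqP/ioI // [->] /orP[] /eqP/ioI // [->].
rewrite -cE; pose G := SGraph ok.
rewrite -[#|EE|]/(#|edges G|); apply: leq_bigmax_cond.
apply/existsP => -[g /andP[/injectiveP gI /forall_inP gE]].
have t0 : 0 < t by apply: leq_ltn_trans Tt.
pose i0 := Ordinal s0; pose j0 := Ordinal t0.
have ad i j : exists x y, e (val x) (val y) /\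
    ((g (inl i) = io (inl x) /\ g (inr j) = io (inr y)) \/
     (g (inl i) = io (inr y) /\ g (inr j) = io (inl x))).
  apply: edP; have := gE [set inl i; inr j]; rewrite imsetU1 imset_set1; apply.
  by apply/imsetP; exists (i, j).
have [x0 [y0 [_ [[gi0 gj0]|[gi0 gj0]]]]] := ad i0 j0.
- have hj j : exists y, g (inr j) = io (inr y).
    have [x [y [_ [[_ ->]|[h _]]]]] := ad i0 j; first by exists y.
    by move: h; rewrite gi0 => /ioI.
  have hi i : exists x, g (inl i) = io (inl x).
    have [x [y [_ [[-> _]|[_ h]]]]] := ad i j0; first by exists x.
    by move: h; rewrite gj0 => /ioI.
  have [x hx] := fin_all_exists hi; have [y hy] := fin_all_exists hj.
  have exy i j : e (val (x i)) (val (y j)).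
    have [x1 [y1 [h [[]|[]]]]] := ad i j; rewrite hx hy => /ioI // [->] /ioI [->] //.
  have xI : injective (val \o x) by move=> i i' /val_inj h; have := hx i; rewrite h -hx => /gI [].
  have yI : injective (val \o y) by move=> i i' /val_inj h; have := hy i; rewrite h -hy => /gI [].
  have := hA [set (val \o x) i | i in 'I_s].
  rewrite card_imset // card_ord => /(_ _ erefl) h.
  move: Tt; rewrite ltnNge => /negP; apply; apply: leq_trans (h _); last first.
    by apply/subsetP => _ /imsetP[i _ ->]; apply: valP.
  rewrite -[t in t <= _]card_ord -(card_imset _ yI); apply: subset_leq_card.
  apply/subsetP => _ /imsetP[j _ ->]; rewrite inE (valP (y j)) /=.
  by apply/forall_inP => _ /imsetP[i _ ->]; apply: exy.
- have hj j : exists y, g (inr j) = io (inl y).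
    have [x [y [_ [[h _]|[_ ->]]]]] := ad i0 j; last by exists x.
    by move: h; rewrite gi0 => /ioI.
  have hi i : exists x, g (inl i) = io (inr x).
    have [x [y [_ [[_ h]|[-> _]]]]] := ad i j0; last by exists y.
    by move: h; rewrite gj0 => /ioI.
  have [x hx] := fin_all_exists hi; have [y hy] := fin_all_exists hj.
  have exy i j : e (val (y j)) (val (x i)).
    have [x1 [y1 [h [[]|[]]]]] := ad i j; rewrite hx hy => /ioI // [->] /ioI [->] //.
  have xI : injective (val \o x) by move=> i i' /val_inj h; have := hx i; rewrite h -hx => /gI [].
  have yI : injective (val \o y) by move=> i i' /val_inj h; have := hy i; rewrite h -hy => /gI [].
  have := hB [set (val \o x) i | i in 'I_s].
  rewrite card_imset // card_ord => /(_ _ erefl) h.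
  move: Tt; rewrite ltnNge => /negP; apply; apply: leq_trans (h _); last first.
    by apply/subsetP => _ /imsetP[i _ ->]; apply: valP.
  rewrite -[t in t <= _]card_ord -(card_imset _ yI); apply: subset_leq_card.
  apply/subsetP => _ /imsetP[j _ ->]; rewrite inE (valP (y j)) /=.
  by apply/forall_inP => _ /imsetP[i _ ->]; apply: exy.
Qed.

Lemma cube_root_choice s : 2 <= s -> exists r,
  [/\ r ^ 3 <= 8 * s ^ 2, 2 <= r & s ^ 2 + 1 <= 'C(r + 4, 3)].
Proof.
move=> s2; pose P r := r ^ 3 <= 8 * s ^ 2.
have P2 : exists r, P r by exists 2; rewrite /P leq_pmulr // expn_gt0; lia.
have bd r : P r -> r <= 8 * s ^ 2.
  by apply: leq_trans; rewrite !expnS expn0; case: r => // r; rewrite muln1 leq_pmulr.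
exists (ex_maxn P2 bd); case: ex_maxnP => r Pr rmax; split=> //.
  by apply: rmax; rewrite /P leq_pmulr // expn_gt0; lia.
have r2 : 2 <= r by apply: rmax; rewrite /P leq_pmulr // expn_gt0; lia.
have hr : 8 * s ^ 2 < r.+1 ^ 3 by rewrite ltnNge; apply/negP => /rmax; rewrite ltnn.
have e : 'C(r + 4, 3) * 6 = (r + 4) * ((r + 3) * (r + 2)).
  by rewrite -[6]/(3`!) bin_ffact !addnS addn0 !ffactnS ffactn0 /= muln1.
rewrite -(leq_pmul2r (isT : 0 < 6)) e.
by move: hr; rewrite !expnS !expn0; nia.
Qed.

Lemma power_choice s n N : 0 < s -> 4 * (2 ^ N) ^ s <= n -> exists j,
  [/\ N <= j, 4 * (2 ^ j) ^ s <= n & n < 4 * (2 ^ j.+1) ^ s].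
Proof.
move=> s0 hN; pose P j := 4 * (2 ^ j) ^ s <= n.
have bd j : P j -> j <= n.
  apply: leq_trans; apply: (@leq_trans (2 ^ j)); first exact/ltnW/ltn_expl.
  apply: (@leq_trans ((2 ^ j) ^ s)); last exact: leq_pmull.
  by rewrite -{1}[2 ^ j]expn1 leq_pexp2l // expn_gt0.
exists (ex_maxn (ex_intro P N hN) bd); case: ex_maxnP => j Pj jmax; split=> //.
  exact: jmax.
by rewrite ltnNge; apply/negP => /jmax; rewrite ltnn.
Qed.

Lemma extremal_biclique_nat s : 2 <= s -> exists r, r ^ 3 <= 8 * s ^ 2 /\
  forall t, 9 ^ s * (s ^ 2) ^ r < t -> exists N, forall n, N <= n ->
  exists q, [/\ 0 < q, n < 4 * (2 * q) ^ s
    & q ^ s * q ^ s <= 8 * (q * extremal n (biclique s t))].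
Proof.
move=> hs; have s0 : 0 < s by apply: ltnW.
have [r [hr r2 hC]] := cube_root_choice hs.
have [q0 hq0] := RandomVarieties.bipartite_construction s0 r2 hC (leqnn _).
exists r; split=> // t Tt; exists (4 * (2 ^ q0) ^ s) => n hn.
have [j [qj jn nj]] := power_choice s0 hn.
have [|V [X [Y [e]]]] := hq0 j.
  by apply: (@leq_trans (2 ^ q0)); rewrite ?leq_exp2l // ltnW // ltn_expl.
move=> [/andP[X1 X2] /andP[Y1 Y2] hE hA hB]; exists (2 ^ j).
rewrite -expnS nj expn_gt0; split=> //; set q := 2 ^ j in jn X1 X2 Y1 Y2 hE *.
have exE := extremal_ge s0 Tt (_ : #|X| + #|Y| <= n) hA hB.
have {}exE := exE ltac:(move: X2 Y2 jn; lia).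
apply: leq_trans (leq_mul X1 Y1) _.
have := leq_mul (leqnn q) exE; move: hE; lia.
Qed.

Unset Implicit Arguments.
From mathcomp Require Import all_classical all_reals all_analysis.
Import Order.TTheory GRing.Theory Num.Theory.
Local Open Scope classical_set_scope.
Local Open Scope ring_scope.

Lemma powR_threshold (R : realType) (s r : nat) : (0 < s)%N -> (r ^ 3 <= 8 * s ^ 2)%N ->
  (9 ^ s * (s ^ 2) ^ r)%:R <= 9 ^+ s * s%:R `^ (4 * s%:R `^ (2 / 3)) :> R.
Proof.
move=> s0 hr; rewrite natrM natrX -expnM natrX ler_pM2l ?exprn_gt0 ?ltr0n //.
have s1 : 1 <= s%:R :> R by rewrite ler1n.
have sp : 0 <= s%:R :> R by [].
set u : R := s%:R `^ (2 / 3).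
have u0 : 0 <= u by apply: powR_ge0.
have u3 : u ^+ 3 = s%:R ^+ 2.
  by rewrite -powR_mulrn // /u -powRrM -powR_mulrn // mulfVK.
have ru : r%:R <= 2 * u.
  rewrite -(@ler_pXn2r _ 3) ?nnegrE ?mulr_ge0 // exprMn u3 -!natrX -natrM ler_nat.
  exact: hr.
rewrite -powR_mulrn //; apply: ler_powR => //.
by rewrite natrM; move: ru; lra.
Qed.

Theorem theorem1 (R : realType) (s : nat) (hs : (2 <= s)%N) :
  exists2 c : R, 0 < c &
    forall t : nat,
      9 ^+ s * s%:R `^ (4 * s%:R `^ (2 / 3)) < t%:R :> R ->
      \forall n \near \oo,
        c * n%:R `^ (2 - 1 / s%:R) <= (extremal n (biclique s t))%:R.
Proof.
have s0 : (0 < s)%N by apply: ltnW.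
have [r [hr low]] := extremal_biclique_nat hs.
exists ((2 ^ (2 * s + 7))%:R^-1); first by rewrite invr_gt0 ltr0n expn_gt0.
move=> t ht.
have Tt : (9 ^ s * (s ^ 2) ^ r < t)%N.
  by rewrite -(ltr_nat R); apply: le_lt_trans ht; apply: powR_threshold.
have [N hN] := low t Tt; exists N => // n /= /hN[q [q1 nq hE2]].
set ex := extremal _ _ in hE2 *.
pose a : R := 2 - 1 / s%:R.
have sR : 1 <= s%:R :> R by rewrite ler1n.
have a0 : 0 <= a.
  rewrite subr_ge0 ler_pdivrMr ?(lt_le_trans ltr01) //; lra.
have a2 : a <= 2 by rewrite gerBl divr_ge0.
have nle : n%:R <= (2 ^ (s + 2))%:R * (q ^ s)%:R :> R.
  rewrite -natrM ler_nat; apply: leq_trans (ltnW nq) _.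
  by rewrite expnMn expnD; lia.
have h1 : n%:R `^ a <= (2 ^ (2 * s + 4))%:R * (q ^ s)%:R `^ a :> R.
  apply: (@le_trans _ _ (((2 ^ (s + 2))%:R * (q ^ s)%:R) `^ a)).
    by apply: ge0_ler_powR; rewrite ?nnegrE ?mulr_ge0.
  rewrite powRM // ler_pM2r; last by rewrite powR_gt0 // ltr0n expn_gt0 q1.
  apply: (@le_trans _ _ ((2 ^ (s + 2))%:R `^ 2)).
    by apply: ler_powR => //; rewrite ler1n expn_gt0.
  by rewrite powR_mulrn // -natrX -expnM mulnDl mulnC.
have h2 : q%:R * (q ^ s)%:R `^ a = (q ^ s)%:R * (q ^ s)%:R :> R.
  have qs : q%:R = (q ^ s)%:R `^ (1 / s%:R) :> R.
    by rewrite natrX -powR_mulrn // -powRrM mul1r divff ?powRr1 // pnatr_eq0 -lt0n.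
  rewrite {1}qs -powRD; last by rewrite pnatr_eq0 -lt0n expn_gt0 q1 implybT.
  by rewrite /a addrC subrK powR_mulrn // expr2.
rewrite -/a ler_pdivrMl ?ltr0n ?expn_gt0 //; apply: le_trans h1 _.
rewrite (_ : (2 * s + 7 = 2 * s + 4 + 3)%N); last by lia.
rewrite (expnD 2 (2 * s + 4) 3) natrM -mulrA ler_pM2l ?ltr0n ?expn_gt0 //.
rewrite -(@ler_pM2l _ q%:R) ?ltr0n // h2 -!natrM ler_nat.
by move: hE2; lia.
Qed.
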